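(* Let $R$ be a proper subring of $\mathbb{Q}$, let $\Phi$ be a non-empty set of finite-rank-free-by-1 $R$-modules, and let $\kappa>|\Phi|$ be an infinite regular cardinal with $\kappa^{\aleph_0}=\kappa$. Then there exists a torsion-free, $\Phi$-complete, $\Phi$-represented $R$-module $G$ of rank $\kappa$. Moreover, if every module in $\Phi$ has rank at least $n+1$ (for a natural number $n$), then every $R$-submodule of $G$ of rank $\le n$ is free.
   Context: Let $R\subseteq\mathbb{Q}$ be a subring and $n\le\omega$. Let $B$ be the free $R$-module with basis $\{x_i:i<n\}\cup\{y_m:m\in\omega\}$, let $p_m\in R\setminus\{0\}$ and $k_{im}\in R$ with, for each $m$, $k_{im}=0$ for all but finitely many $i$, and let $N$ be the submodule generated by $y_{m+1}p_m-y_m-\sum_{i<n}x_ik_{im}$ $(m\in\omega)$. An $R$-module $G'$ is $n$-free-by-1 if $G'\cong B/N$ for such data, $G'$ is not free, and, if $n$ is finite, every $R$-submodule of $G'$ of rank $\le n$ is free; it is finite-rank-free-by-1 if it is $n$-free-by-1 for some finite $n$. For a set $\Phi$ of such modules: an $R$-module $L$ is $\Phi$-complete if $\mathrm{Ext}(G',L)=0$ for all $G'\in\Phi$; an $R$-module $G$ is $\Phi$-represented if $G=\bigcup_{\alpha<\lambda}G_\alpha$ for an ascending continuous chain of $R$-submodules with $G_0=0$ and each $G_{\alpha+1}/G_\alpha$ isomorphic to a member of $\Phi$ or to a free $R$-module. *)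

(* Defs.v *)
(* R-modules over a subring R of Q are modelled as
   lmodType R, where R comes with an injective ring morphism into rat. *)
From HB Require Import structures.
From mathcomp Require Import all_boot all_order all_algebra.
Set Implicit Arguments. Unset Strict Implicit. Unset Printing Implicit Defensive.
Import GRing.Theory.
Local Open Scope ring_scope.

Definition card_le (A B : Type) : Prop := exists f : A -> B, injective f.
Definition card_lt (A B : Type) : Prop := card_le A B /\ ~ card_le B A.
Definition card_eq (A B : Type) : Prop := exists f : A -> B, bijective f.

Definition infinite_regular (K : Type) : Prop :=
  card_le nat K /\
  forall (J : Type) (U : J -> K -> Prop),
    card_lt J K -> (forall j, card_lt {x : K | U j x} K) ->
    exists x : K, forall j, ~ U j x.

Section Modules.
Variable R : comNzRingType.

Definition is_lin (M N : lmodType R) (f : M -> N) : Prop :=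
  forall (a : R) (x y : M), f (a *: x + y) = a *: f x + f y.

Definition submodule (M : lmodType R) (S : M -> Prop) : Prop :=
  S 0 /\ forall (a : R) (x y : M), S x -> S y -> S (a *: x + y).

Definition independent (M : lmodType R) (B : M -> Prop) : Prop :=
  forall (s : seq M) (c : nat -> R), uniq s ->
    (forall j, (j < size s)%N -> B (nth 0 s j)) ->
    \sum_(j < size s) c j *: nth 0 s j = 0 ->
    forall j, (j < size s)%N -> c j = 0.

Definition span_in (M : lmodType R) (B : M -> Prop) (x : M) : Prop :=
  exists (s : seq M) (c : nat -> R),
    (forall j, (j < size s)%N -> B (nth 0 s j)) /\
    x = \sum_(j < size s) c j *: nth 0 s j.

Definition free_sub (M : lmodType R) (S : M -> Prop) : Prop :=
  exists B : M -> Prop, (forall x, B x -> S x) /\ independent B /\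
    forall x, S x -> span_in B x.

Definition free (M : lmodType R) : Prop := free_sub (fun _ : M => True).

Definition torsion_free (M : lmodType R) : Prop :=
  forall (r : R) (x : M), r *: x = 0 -> r = 0 \/ x = 0.

Definition rank_at_most (M : lmodType R) (S : M -> Prop) (n : nat) : Prop :=
  forall s : seq M, uniq s -> (forall x, x \in s -> S x) ->
    independent (fun x => x \in s) -> (size s <= n)%N.

Definition rank_at_least (M : lmodType R) (n : nat) : Prop :=
  exists s : seq M, [/\ uniq s, size s = n & independent (fun x => x \in s)].

Definition rank_is (M : lmodType R) (K : Type) : Prop :=
  exists f : K -> M, [/\ injective f,
    independent (fun x => exists k, f k = x) &
    forall B : M -> Prop, independent B ->
      (forall k, B (f k)) -> forall x, B x -> exists k, f k = x].

(* n : option nat, with None standing for omega *)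
Definition inN (n : option nat) (i : nat) : bool :=
  if n is Some n' then (i < n')%N else true.

(* M ~= B/N for data (p, k): unfolded as the existence of images
   x_i, y_m in M of the basis of B such that the induced map B -> M is
   surjective with kernel exactly N. *)
Definition presented_by (n : option nat) (M : lmodType R) : Prop :=
  exists (x y : nat -> M) (p : nat -> R) (k : nat -> nat -> R) (bnd : nat -> nat),
  [/\ (forall m, p m != 0),
      (forall i m, ~~ inN n i -> k i m = 0),
      (forall i m, (bnd m <= i)%N -> k i m = 0) &
  [/\ (* the images satisfy the relations (the generators of N map to 0) *)
      (forall m, p m *: y m.+1 - y m - \sum_(i < bnd m) k i m *: x i = 0),
      (forall g : M, exists (N : nat) (a b : nat -> R),
         g = \sum_(i < N | inN n i) a i *: x i + \sum_(m < N) b m *: y m) &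
      (* kernel is contained in N *)
      (forall (N : nat) (a b : nat -> R),
         \sum_(i < N | inN n i) a i *: x i + \sum_(m < N) b m *: y m = 0 ->
         exists (L : nat) (c : nat -> R),
         [/\ (forall m, (L <= m)%N -> c m = 0),
             (forall i, inN n i ->
                (if (i < N)%N then a i else 0) = - \sum_(m < L) c m * k i m) &
             (forall m,
                (if (m < N)%N then b m else 0) =
                (if m is m'.+1 then c m' * p m' else 0) - c m)])]].

Definition free_by_1 (n : option nat) (M : lmodType R) : Prop :=
  [/\ presented_by n M, ~ free M &
      forall n' : nat, n = Some n' ->
        forall S : M -> Prop, submodule S -> rank_at_most S n' -> free_sub S].

Definition finite_rank_free_by_1 (M : lmodType R) : Prop :=
  exists n : nat, free_by_1 (Some n) M.

Definition Ext_zero (Gp L : lmodType R) : Prop :=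
  forall (E : lmodType R) (f : L -> E) (g : E -> Gp),
    is_lin f -> is_lin g -> injective f -> (forall z, exists e, g e = z) ->
    (forall e, g e = 0 <-> exists l, f l = e) ->
    exists s : Gp -> E, is_lin s /\ forall z, g (s z) = z.

Definition Phi_complete (I : Type) (Phi : I -> lmodType R) (L : lmodType R) : Prop :=
  forall i, Ext_zero (Phi i) L.

Definition quot_iso (M : lmodType R) (Bsub Asub : M -> Prop) (N : lmodType R) : Prop :=
  exists phi : M -> N,
    [/\ (forall (a : R) (x y : M), Bsub x -> Bsub y ->
           phi (a *: x + y) = a *: phi x + phi y),
        (forall z, exists x, Bsub x /\ phi x = z) &
        (forall x, Bsub x -> (phi x = 0 <-> Asub x))].

(* M is the union of an ascending continuous chain (G_alpha)_{alpha < lambda},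
   lambda an ordinal (a well-ordered type), G_0 = 0, and each
   G_{alpha+1}/G_alpha isomorphic to a member of Phi or to a free module. *)
Definition Phi_represented (I : Type) (Phi : I -> lmodType R) (M : lmodType R) : Prop :=
  exists (L : Type) (lt : L -> L -> Prop) (Gc : L -> M -> Prop),
  [/\ (forall a b c, lt a b -> lt b c -> lt a c),
      (forall a, ~ lt a a),
      (forall a b, a = b \/ lt a b \/ lt b a) &
      well_founded lt] /\
  [/\ (forall a, submodule (Gc a)),
      (forall a b, lt a b -> forall x, Gc a x -> Gc b x) &
      (forall a, (forall b, ~ lt b a) -> forall x, Gc a x <-> x = 0)] /\
  (forall a, (exists b, lt b a) ->
     (~ exists b, lt b a /\ forall c, ~ (lt b c /\ lt c a)) ->
     forall x, Gc a x <-> exists b, lt b a /\ Gc b x) /\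
  (forall x, exists a, Gc a x) /\
  (forall a b, lt a b -> (forall c, ~ (lt a c /\ lt c b)) ->
     (exists i, quot_iso (Gc b) (Gc a) (Phi i)) \/
     (exists F : lmodType R, free F /\ quot_iso (Gc b) (Gc a) F)).

End Modules.

(* Main.v *)
From HB Require Import structures.
From mathcomp Require Import all_boot all_order all_algebra.
From mathcomp Require Import boolp classical_sets functions cardinality wochoice.
Require Import Defs.
Import GRing.Theory.
Set Implicit Arguments.
Unset Strict Implicit.
Unset Printing Implicit Defensive.
Local Open Scope ring_scope.

(** G is realized inside a rational vector space. Its generators are indexed by
    the nodes of a well-founded, countably branching tree type: a node consists
    of an index i and a sequence of formal R-combinations of generators of other
    nodes, and it contributes generators x_j, y_m subject to the relations of
    Phi i with that sequence as right-hand sides. Every sequence in G is then the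
    right-hand side of some node, so every extension of Phi i by G splits.
    A node is coded by the labels along its finite paths, so there are at most
    kappa^omega = kappa nodes. Any well-order extending the subterm relation
    filters G by supports; the coordinates at a node identify the corresponding
    quotient with Phi i. A submodule of finite rank has finite support,
    and is built from free pieces by removing the largest node repeatedly. *)

(** * Linear maps, submodules and independence *)

(** Completeness asks that every sequence of elements of G be a right-hand side, while right-hand
    sides are themselves made of generators of G. Syntax breaks this circle: right-hand sides are
    named before anything has a value, and values are assigned afterwards by recursion on the node.
    One node has room for a whole sequence, so nothing has to be closed off stage by stage. A
    rational space is the right place for the values because division by p_m is possible and unique
    there: y_0 gets a fresh coordinate and the relations determine every later y_m. All stages are
    subsets of one space, and no direct limits or transition maps arise. The crux is that support
    and generation agree: an element of G supported at nodes up to a must be a combination of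
    generators of those nodes. At a single node the x_i and any one y_N have independent
    coordinates, so a node that the support does not show contributes nothing at the top and can be
    discarded. *)

Section Linear.
Variable R : comNzRingType.
Implicit Types M N : lmodType R.

Lemma is_lin0 M N (f : M -> N) : is_lin f -> f 0 = 0.
Proof. by move=> lf; have := lf (-1) 0 0; rewrite !scaleN1r oppr0 addr0 addNr. Qed.

Lemma is_linZ M N (f : M -> N) a x : is_lin f -> f (a *: x) = a *: f x.
Proof. by move=> lf; have := lf a x 0; rewrite !addr0 is_lin0 // addr0. Qed.

Lemma is_linD M N (f : M -> N) x y : is_lin f -> f (x + y) = f x + f y.
Proof. by move=> lf; have := lf 1 x y; rewrite !scale1r. Qed.

Lemma is_linB M N (f : M -> N) x y : is_lin f -> f (x - y) = f x - f y.
Proof.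
by move=> lf; rewrite is_linD // -scaleN1r is_linZ // scaleN1r.
Qed.

Lemma is_lin_sum M N (f : M -> N) J (r : seq J) (P : pred J) (F : J -> M) :
  is_lin f -> f (\sum_(j <- r | P j) F j) = \sum_(j <- r | P j) f (F j).
Proof.
by move=> lf; apply: (big_morph f); [move=> x y; exact: is_linD|exact: is_lin0].
Qed.

Section Submodule.
Variables (M : lmodType R) (S : M -> Prop).
Hypothesis sS : submodule S.

Lemma submodule0 : S 0. Proof. by case: sS. Qed.

Lemma submoduleD x y : S x -> S y -> S (x + y).
Proof. by move=> Sx Sy; rewrite -[x]scale1r; apply: sS.2. Qed.

Lemma submoduleZ a x : S x -> S (a *: x).
Proof. by move=> Sx; rewrite -[_ *: _]addr0; apply: sS.2 => //; exact: submodule0. Qed.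

Lemma submoduleN x : S x -> S (- x).
Proof. by move=> Sx; rewrite -scaleN1r; exact: submoduleZ. Qed.

Lemma submoduleB x y : S x -> S y -> S (x - y).
Proof. by move=> Sx Sy; apply: submoduleD => //; exact: submoduleN. Qed.

Lemma submodule_sum J (r : seq J) (P : pred J) (F : J -> M) :
  (forall j, P j -> S (F j)) -> S (\sum_(j <- r | P j) F j).
Proof.
by move=> SF; apply: big_ind; [exact: submodule0|exact: submoduleD|].
Qed.

End Submodule.

Lemma independentP M (B : M -> Prop) :
  independent B <-> (forall (s : seq M) (c : M -> R), uniq s ->
    (forall x, x \in s -> B x) -> \sum_(x <- s) c x *: x = 0 ->
    forall x, x \in s -> c x = 0).
Proof.
split=> [iB s c us sB sc0 x xs|iB s c us sB sc0 j js].
  rewrite -(nth_index 0 xs).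
  apply: (iB s (fun j => c (nth 0 s j))) => //; last by rewrite index_mem.
    by move=> j js; apply/sB/mem_nth.
  by rewrite (big_nth 0) big_mkord in sc0.
have := iB s (fun x => c (index x s)) us _ _ (nth 0 s j) (mem_nth 0 js).
rewrite index_uniq //; apply.
  by move=> x xs; rewrite -(nth_index 0 xs); apply: sB; rewrite index_mem.
rewrite (big_nth 0) big_mkord -[RHS]sc0; apply: eq_bigr => i _.
by rewrite index_uniq.
Qed.

Lemma span_inP M (B : M -> Prop) (x : M) :
  span_in B x <-> exists s : seq (R * M),
    (forall z, z \in s -> B z.2) /\ x = \sum_(z <- s) z.1 *: z.2.
Proof.
split=> [[s [c [sB ->]]]|[s [sB ->]]].
  exists [seq (c j, nth 0 s j) | j <- iota 0 (size s)]; split.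
    by move=> z /mapP[j]; rewrite mem_iota add0n => /andP[_ js] -> /=; exact: sB.
  by rewrite big_map -[in RHS](subn0 (size s)) big_mkord.
exists [seq z.2 | z <- s], (fun j => (nth (0, 0) s j).1); split.
  move=> j; rewrite size_map => js; rewrite (nth_map (0, 0)) //.
  exact/sB/mem_nth.
rewrite (big_nth (0, 0)) big_mkord size_map; apply: eq_bigr => i _.
by rewrite (nth_map (0, 0)).
Qed.

Lemma span_in_submodule M (B : M -> Prop) : submodule (span_in B).
Proof.
split=> [|a x y /span_inP[s [sB ->]] /span_inP[t [tB ->]]].
  by apply/span_inP; exists [::]; rewrite big_nil.
apply/span_inP; exists ([seq (a * z.1, z.2) | z <- s] ++ t); split.
  move=> z; rewrite mem_cat => /orP[/mapP[w ws ->]|/tB//].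
  exact: (sB w ws).
rewrite big_cat big_map scaler_sumr; congr (_ + _).
by apply: eq_bigr => z _; rewrite scalerA.
Qed.

Lemma span_in_mem M (B : M -> Prop) x : B x -> span_in B x.
Proof.
move=> Bx; apply/span_inP; exists [:: (1, x)]; split; last first.
  by rewrite big_seq1 scale1r.
by move=> z; rewrite inE => /eqP ->.
Qed.

Lemma span_in_sub M (B C : M -> Prop) x :
  (forall z, B z -> C z) -> span_in B x -> span_in C x.
Proof.
by move=> BC [s [c [sB ->]]]; exists s, c; split=> // j js; apply/BC/sB.
Qed.

Lemma independent_neq0 M (B : M -> Prop) x : independent B -> B x -> x != 0.
Proof.
move=> /independentP iB Bx; apply/eqP => x0.
have := iB [:: x] (fun=> 1) isT _ _ x; rewrite big_seq1 scale1r inE eqxx.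
move=> /(_ _ x0 isT) h; have := oner_neq0 R; rewrite h ?eqxx //.
by move=> y; rewrite inE => /eqP ->.
Qed.

Section FreeExtension.
Variables (M N : lmodType R) (S : M -> Prop) (phi : M -> N).
Hypothesis sS : submodule S.
Hypothesis phi_lin : forall a x y, S x -> S y ->
  phi (a *: x + y) = a *: phi x + phi y.

Let phi0 : phi 0 = 0.
Proof.
have := phi_lin (-1) (submodule0 sS) (submodule0 sS).
by rewrite !scaleN1r oppr0 addr0 addNr.
Qed.

Let phiB x y : S x -> S y -> phi (x - y) = phi x - phi y.
Proof.
by move=> Sx Sy; rewrite addrC -scaleN1r phi_lin // scaleN1r addrC.
Qed.

Lemma partial_lin_sum (r : seq M) (c : M -> R) :
  (forall x, x \in r -> S x) ->
  phi (\sum_(x <- r) c x *: x) = \sum_(x <- r) c x *: phi x.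
Proof.
elim: r => [|x r IH] rS; first by rewrite !big_nil.
have rS' y : y \in r -> S y by move=> yr; apply: rS; rewrite inE yr orbT.
rewrite !big_cons phi_lin ?IH //; first by apply: rS; rewrite mem_head.
by rewrite big_seq; apply: submodule_sum => // y yr; apply: submoduleZ => //; exact: rS'.
Qed.

(** A basis consists of a basis of the kernel and of lifts [l z] of a basis of the image; vanishing
    of [phi] tells the two kinds apart. Linearity of [phi] is asked on [S] only, as [quot_iso]
    grants no more. *)
Lemma free_sub_extension :
  free_sub (fun x => S x /\ phi x = 0) ->
  free_sub (fun z => exists2 x, S x & phi x = z) -> free_sub S.
Proof.
move=> [B [BS [iB spB]]] [C [CS [iC spC]]].
have /choice[l lP] : forall z, exists x, C z -> S x /\ phi x = z.
  move=> z; have [/CS[x Sx <-]|nC] := pselect (C z); first by exists x.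
  by exists 0.
pose D x := B x \/ exists2 z, C z & x = l z.
have DS x : D x -> S x by case=> [/BS[]//|[z Cz ->]]; case: (lP z Cz).
exists D; split => //; split.
  apply/independentP => s c us sD sc0.
  have sS' x : x \in s -> S x by move=> /sD/DS.
  pose s1 := [seq x <- s | phi x == 0]; pose s2 := [seq x <- s | phi x != 0].
  have sB x : x \in s -> phi x = 0 -> B x.
    move=> xs px0; have [//|[z Cz xz]] := sD x xs.
    have /eqP := independent_neq0 iC Cz.
    by have [_ <-] := lP z Cz; rewrite -xz px0.
  have sC x : x \in s -> phi x != 0 -> C (phi x) /\ x = l (phi x).
    move=> xs px0; have [/BS[_ /eqP]|[z Cz xz]] := sD x xs; first by rewrite (negPf px0).
    by rewrite xz; have [_ ->] := lP z Cz.
  have c2 x : x \in s -> phi x != 0 -> c x = 0.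
    move=> xs px0; have [Cx xl] := sC x xs px0.
    have /independentP := iC.
    move=> /(_ [seq phi y | y <- s2] (c \o l)) h; rewrite xl.
    apply: (h _ _ _ (phi x)).
    - rewrite map_inj_in_uniq ?filter_uniq // => y z.
      rewrite !mem_filter => /andP[y0 ys] /andP[z0 zs] pyz.
      by rewrite (sC y ys y0).2 pyz -(sC z zs z0).2.
    - by move=> _ /mapP[y + ->]; rewrite mem_filter => /andP[y0 ys]; case: (sC y ys y0).
    - have := congr1 phi sc0; rewrite phi0 partial_lin_sum // => ph0.
      rewrite big_map big_filter -[RHS]ph0 [in RHS](bigID (fun y => phi y == 0)) /=.
      rewrite [X in _ = X + _]big1 ?add0r; last by move=> y /eqP ->; rewrite scaler0.
      rewrite big_seq_cond [in RHS]big_seq_cond; apply: eq_bigr => y /andP[ys y0].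
      by rewrite -(sC y ys y0).2.
    - by apply: map_f; rewrite mem_filter px0.
  move=> x xs; have [px0|] := eqVneq (phi x) 0; last exact: c2.
  have /independentP/(_ s1 c) h := iB; apply: h.
  - exact: filter_uniq.
  - by move=> y; rewrite mem_filter => /andP[/eqP y0 ys]; exact: sB.
  - rewrite big_filter -[RHS]sc0 [in RHS](bigID (fun y => phi y == 0)) /=.
    rewrite [X in _ = _ + X]big_seq_cond [X in _ = _ + X]big1 ?addr0 //.
    by move=> y /andP[ys y0]; rewrite c2 // scale0r.
  - by rewrite mem_filter px0 eqxx.
move=> x Sx; have /span_inP[s [sC px]] : span_in C (phi x) by apply: spC; exists x.
pose y := \sum_(z <- s) z.1 *: l z.2.
have Sy : S y.
  rewrite /y big_seq; apply: submodule_sum => // z /sC/lP[Sz _].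
  exact: submoduleZ.
have py : phi y = phi x.
  rewrite px /y; elim: (s) sC => [|z t IH] tC; first by rewrite !big_nil.
  have tC' w : w \in t -> C w.2 by move=> wt; apply: tC; rewrite inE wt orbT.
  rewrite !big_cons; have [Sz pz] := lP _ (tC z (mem_head _ _)).
  rewrite phi_lin ?pz ?IH // big_seq; apply: submodule_sum => // w /tC'/lP[Sw _].
  exact: submoduleZ.
have Dy : span_in D y.
  rewrite /y big_seq; apply: (submodule_sum (span_in_submodule D)) => z /sC Cz.
  apply: (submoduleZ (span_in_submodule D)); apply: span_in_mem; right.
  by exists z.2.
rewrite -(subrK y x); apply: (submoduleD (span_in_submodule D)) => //.
apply: (@span_in_sub _ B) => [z Bz|]; first by left.
by apply: spB; split; [exact: submoduleB|rewrite phiB // py subrr].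
Qed.

(** Lifts of independent elements are independent, since [phi] carries every relation among the
    lifts down to the image. *)
Lemma rank_at_most_image n :
  rank_at_most S n -> rank_at_most (fun z => exists2 x, S x & phi x = z) n.
Proof.
move=> rS s us sS' /independentP iS.
have /choice[l lP] : forall z, exists x, z \in s -> S x /\ phi x = z.
  move=> z; have [zs|] := boolP (z \in s); last by exists 0.
  by have [x Sx <-] := sS' z zs; exists x.
rewrite -(size_map l s); apply: rS.
- rewrite map_inj_in_uniq // => y z ys zs yz.
  by rewrite -(lP y ys).2 -(lP z zs).2 yz.
- by move=> _ /mapP[z zs ->]; case: (lP z zs).
apply/independentP => t c ut ts tc0 x xt.
have tS y : y \in t -> S y by move=> /ts/mapP[z zs ->]; case: (lP z zs).
have tl y : y \in t -> y = l (phi y).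
  by move=> /ts/mapP[z zs ->]; rewrite (lP z zs).2.
rewrite (tl x xt); apply: (iS [seq phi y | y <- t] (c \o l)).
- by rewrite map_inj_in_uniq // => y z yt zt yz; rewrite (tl y yt) yz -tl.
- by move=> _ /mapP[y /ts/mapP[z zs ->] ->]; rewrite (lP z zs).2.
- have := congr1 phi tc0; rewrite phi0 partial_lin_sum // big_map => tc1.
  rewrite -[RHS]tc1; apply: eq_big_seq => y yt /=; by rewrite -tl.
- exact: map_f.
Qed.

End FreeExtension.

End Linear.

(** * Presentations *)

Section Presentation.
Variable R : comNzRingType.
Implicit Types M E : lmodType R.

Definition pres_rel n (p : nat -> R) (k : nat -> nat -> R) M (x y : nat -> M) :=
  forall m, p m *: y m.+1 = y m + \sum_(i < n) k i m *: x i.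

(** The condition that the kernel is N appears here as the universal property of B/N. Both the
    embedding into a rational space and the splitting of extensions are applications of it. *)
Definition pres n (p : nat -> R) (k : nat -> nat -> R) M (x y : nat -> M) :=
  [/\ forall m, p m != 0,
      pres_rel n p k x y,
      forall g, exists (N : nat) (a b : nat -> R),
        g = \sum_(i < n) a i *: x i + \sum_(m < N) b m *: y m &
      forall E (x' y' : nat -> E), pres_rel n p k x' y' ->
        exists2 s : M -> E, is_lin s &
          (forall i, (i < n)%N -> s (x i) = x' i) /\ (forall m, s (y m) = y' m)].

Lemma sum_trunc M (F : nat -> M) n N :
  \sum_(i < N | (i < n)%N) F i = \sum_(i < n) (if (i < N)%N then F i else 0).
Proof.
rewrite -(big_mkord (fun i => i < n)%N F)
  -(big_mkord xpredT (fun i => if (i < N)%N then F i else 0)).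
rewrite -[RHS]big_mkcond /=.
rewrite (big_nat_widen 0 N (maxn n N)) ?leq_maxr //.
rewrite (big_nat_widen 0 n (maxn n N)) ?leq_maxl //.
by apply: eq_bigl => i; rewrite andbC.
Qed.

Lemma sum_by_parts M (y : nat -> M) (p c b : nat -> R) N L :
  (forall m, (L <= m)%N -> c m = 0) ->
  (forall m, (if (m < N)%N then b m else 0) =
             (if m is m'.+1 then c m' * p m' else 0) - c m) ->
  \sum_(m < N) b m *: y m = \sum_(m < L) c m *: (p m *: y m.+1 - y m).
Proof.
(* The extra one absorbs the shift of the index: at the last index [maxn N L] the coefficient [c]
   vanishes, and with it the boundary term. *)
move=> c0 bc; pose Q := (maxn N L).+1.
have -> : \sum_(m < N) b m *: y m = \sum_(m < Q) (if (m < N)%N then b m else 0) *: y m.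
  rewrite -(big_mkord xpredT (fun m => b m *: y m)).
  rewrite (big_nat_widen 0 N Q) /=; last by rewrite leqW ?leq_maxl.
  rewrite big_mkord big_mkcond; apply: eq_bigr => i _.
  by case: ifP => //; rewrite scale0r.
have -> : \sum_(m < L) c m *: (p m *: y m.+1 - y m)
        = \sum_(m < Q) c m *: (p m *: y m.+1 - y m).
  rewrite -(big_mkord xpredT (fun m => c m *: (p m *: y m.+1 - y m))).
  rewrite (big_nat_widen 0 L Q) /=; last by rewrite leqW ?leq_maxr.
  rewrite big_mkord big_mkcond; apply: eq_bigr => i _ /=.
  by case: ltnP => // /c0 ->; rewrite scale0r.
under eq_bigr do rewrite bc scalerBl.
under [RHS]eq_bigr do rewrite scalerBr scalerA.
rewrite !sumrB; congr (_ - _).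
rewrite big_ord_recl scale0r add0r big_ord_recr /=.
by rewrite c0 ?leq_maxr // mul0r scale0r addr0.
Qed.

Lemma presented_pres n M : presented_by (Some n) M ->
  exists p k (x y : nat -> M), pres n p k x y.
Proof.
move=> [x [y [p [k [bnd [p0 kn kb [rel gen ker]]]]]]].
have sumk E (z : nat -> E) m :
    \sum_(i < bnd m) k i m *: z i = \sum_(i < n) k i m *: z i.
  have -> : \sum_(i < bnd m) k i m *: z i
          = \sum_(i < bnd m | (i < n)%N) k i m *: z i.
    rewrite [RHS]big_mkcond; apply: eq_bigr => i _; case: ifP => // /negbT h.
    by rewrite kn // scale0r.
  rewrite (sum_trunc (fun i => k i m *: z i)); apply: eq_bigr => i _.
  by case: ltnP => // h; rewrite kb // scale0r.
exists p, k, x, y; split=> //.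
- move=> m; have /eqP := rel m; rewrite sumk -addrA -opprD subr_eq0 => /eqP ->.
  by [].
- move=> g; have [N [a [b ->]]] := gen g.
  exists N, (fun i => if (i < N)%N then a i else 0), b; congr (_ + _).
  rewrite [LHS](sum_trunc (fun i => a i *: x i)); apply: eq_bigr => i _.
  by case: ifP; rewrite // scale0r.
move=> E x' y' rel'.
(* [ev] evaluates a formal combination in a given module. By the kernel condition, what evaluates to
   0 in [M] does so in [E], hence sending values in [M] to values in [E] is well defined. *)
pose ev M (x y : nat -> M) N (a b : nat -> R) :=
  \sum_(i < N | inN (Some n) i) a i *: x i + \sum_(m < N) b m *: y m.
have ev0 N a b : ev M x y N a b = 0 -> ev E x' y' N a b = 0.
  move=> /ker[L [c [c0 ca cb]]]; rewrite /ev (sum_by_parts _ c0 cb).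
  rewrite (sum_trunc (fun i => a i *: x' i)).
  have -> : \sum_(i < n) (if (i < N)%N then a i *: x' i else 0)
          = \sum_(i < n) - \sum_(m < L) (c m * k i m) *: x' i.
    apply: eq_bigr => i _; rewrite -scaler_suml -scaleNr -(ca i (ltn_ord i)).
    by case: ifP; rewrite // scale0r.
  rewrite sumrN exchange_big /= addrC; apply/eqP; rewrite subr_eq0; apply/eqP.
  apply: eq_bigr => m _; rewrite rel' addrC addKr scaler_sumr.
  by apply: eq_bigr => i _; rewrite scalerA.
have evlin M' (u v : nat -> M') N N' r a b a' b' :
    r *: ev M' u v N a b + ev M' u v N' a' b' =
    ev M' u v (maxn N N')
      (fun i => r * (if (i < N)%N then a i else 0) + (if (i < N')%N then a' i else 0))
      (fun i => r * (if (i < N)%N then b i else 0) + (if (i < N')%N then b' i else 0)).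
  have widen P Q (F : nat -> R) (z : nat -> M') (D : pred nat) : (P <= Q)%N ->
      \sum_(i < P | D i) F i *: z i
      = \sum_(i < Q | D i) (if (i < P)%N then F i else 0) *: z i.
    move=> PQ; rewrite -(big_mkord D (fun i => F i *: z i)).
    rewrite (big_nat_widen 0 P Q) // big_mkord big_mkcondr.
    by apply: eq_bigr => i _; case: ifP; rewrite // scale0r.
  rewrite /ev (widen N (maxn N N')) ?leq_maxl // (widen N' (maxn N N')) ?leq_maxr //.
  rewrite (widen N (maxn N N') b v xpredT) ?leq_maxl //.
  rewrite (widen N' (maxn N N') b' v xpredT) ?leq_maxr //.
  rewrite scalerDr addrACA !scaler_sumr -!big_split /=.
  by congr (_ + _); apply: eq_bigr => i _; rewrite scalerDl scalerA.
have /choice[s sP] : forall g, exists e, exists N a b,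
    g = ev M x y N a b /\ e = ev E x' y' N a b.
  move=> g; have [N [a [b gE]]] := gen g.
  by exists (ev E x' y' N a b), N, a, b.
have sE N a b : s (ev M x y N a b) = ev E x' y' N a b.
  have [N' [a' [b' [gE ->]]]] := sP (ev M x y N a b).
  apply/eqP; rewrite -subr_eq0 -scaleN1r addrC evlin; apply/eqP/ev0.
  by rewrite -evlin -gE scaleN1r addNr.
exists s; last split.
- move=> r u v; have [N [a [b [-> _]]]] := sP u; have [N' [a' [b' [-> _]]]] := sP v.
  by rewrite !sE !evlin sE.
- have evx M' (u v : nat -> M') i : (i < n)%N ->
      ev M' u v i.+1 (fun j => (j == i)%:R) (fun=> 0) = u i.
    move=> lin; rewrite /ev [X in _ + X]big1 ?addr0; last by move=> m _; rewrite scale0r.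
    rewrite (bigD1 (@ord_max i)) //= eqxx scale1r big1 ?addr0 // => j /andP[_ ji].
    by rewrite (_ : (j == i :> nat) = false) ?scale0r //; apply/negbTE.
  by move=> i lin; rewrite -(evx M x y) // sE evx.
- have evy M' (u v : nat -> M') m :
      ev M' u v m.+1 (fun=> 0) (fun j => (j == m)%:R) = v m.
    rewrite /ev [X in X + _]big1 ?add0r; last by move=> i _; rewrite scale0r.
    rewrite (bigD1 (@ord_max m)) //= eqxx scale1r big1 ?addr0 // => j ji.
    by rewrite (_ : (j == m :> nat) = false) ?scale0r //; apply/negbTE.
  by move=> m; rewrite -(evy M x y) sE evy.
Qed.

(* Every element of the module generated by S, x_i, y_m is, modulo S, a
   combination of the x_i and a single y_N, with N as large as we please. *)
Section NormalForm.
Variables (n : nat) (p : nat -> R) (k : nat -> nat -> R).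
Variables (E : lmodType R) (S : E -> Prop) (x y : nat -> E).
Hypothesis sS : submodule S.
Hypothesis rel : forall m, S (p m *: y m.+1 - (y m + \sum_(i < n) k i m *: x i)).

Definition nf N v := exists (a : nat -> R) (b : R),
  S (v - (\sum_(i < n) a i *: x i + b *: y N)).

Lemma nf_submodule N : submodule (nf N).
Proof.
split=> [|r u v [a [b Su]] [a' [b' Sv]]].
  exists (fun=> 0), 0; rewrite scale0r addr0 big1 ?subr0; first exact: submodule0.
  by move=> i _; rewrite scale0r.
exists (fun i => r * a i + a' i), (r * b + b').
have := sS.2 r _ _ Su Sv; congr S.
rewrite scalerBr addrACA -opprD; congr (_ - _).
rewrite scalerDr addrACA scaler_sumr -big_split /= scalerA -scalerDl.
by congr (_ + _); apply: eq_bigr => i _; rewrite scalerDl scalerA.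
Qed.

Lemma nfX N i : (i < n)%N -> nf N (x i).
Proof.
move=> lin; exists (fun j => (j == i)%:R), 0.
rewrite scale0r addr0 (bigD1 (Ordinal lin)) //= eqxx scale1r big1 ?addr0.
  by rewrite subrr; exact: submodule0.
move=> j ji; rewrite (_ : (j == i :> nat) = false) ?scale0r //.
exact/negbTE.
Qed.

Lemma nf_base N v : S v -> nf N v.
Proof.
move=> Sv; exists (fun=> 0), 0; rewrite scale0r addr0 big1 ?subr0 // => i _.
by rewrite scale0r.
Qed.

(** Modulo [S] the relation expresses y_m through y_(m+1), but not conversely, as p_m may be a
    non-unit; indices can only be raised. *)
Lemma nfY m N : (m <= N)%N -> nf N (y m).
Proof.
move=> /subnK <-; move: (N - m)%N => d; elim: d m => [|d IH] m.
  exists (fun=> 0), 1; rewrite scale1r add0n big1 ?add0r.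
    by rewrite subrr; exact: submodule0.
  by move=> i _; rewrite scale0r.
rewrite addSnnS.
have -> : y m = p m *: y m.+1 - \sum_(i < n) k i m *: x i
    - (p m *: y m.+1 - (y m + \sum_(i < n) k i m *: x i)).
  by rewrite opprB [RHS]addrC addrA subrK addrK.
apply: (submoduleB (nf_submodule _)); last exact: nf_base.
apply: (submoduleB (nf_submodule _)); first exact/(submoduleZ (nf_submodule _)).
by apply: submodule_sum => [|i _]; [exact: nf_submodule|
  apply: submoduleZ; [exact: nf_submodule|exact: nfX]].
Qed.

End NormalForm.

Lemma pres_nf n p k M (x y : nat -> M) : pres n p k x y ->
  forall g, exists N (a : nat -> R) (b : R),
    g = \sum_(i < n) a i *: x i + b *: y N.
Proof.
move=> [_ rel gen _] g; have [N [a [b gE]]] := gen g.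
have s0 : submodule (fun v : M => v = 0).
  by split=> // r u v -> ->; rewrite scaler0 addr0.
have : nf n (fun v => v = 0) x y N g.
  rewrite gE; apply: (submoduleD (nf_submodule n x y s0 N)).
    by apply: submodule_sum => [|i _]; [exact: nf_submodule|
  apply: submoduleZ; [exact: nf_submodule|exact: nfX]].
  apply: submodule_sum => [|i _]; first exact: nf_submodule.
  apply: submoduleZ; first exact: nf_submodule.
  apply: (nfY (p := p) (k := k)) => //; last exact: ltnW.
  by move=> m; rewrite rel subrr.
by move=> [a' [b' /eqP]]; rewrite subr_eq0 => /eqP ->; exists N, a', b'.
Qed.

End Presentation.

(** * Realization in a rational vector space *)

(** A copy of [rat] whose type records [iota], so that scaling through [iota] can be its [R]-module
    structure. *)
Definition qmod (R : comNzRingType) (iota : {rmorphism R -> rat}) : Type := rat.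

Section Qmod.
Variables (R : comNzRingType) (iota : {rmorphism R -> rat}).
HB.instance Definition _ := GRing.Zmodule.copy (qmod iota) rat.

Definition qscale (r : R) (q : qmod iota) : qmod iota := iota r * (q : rat).

Fact qscaleA a b q : qscale a (qscale b q) = qscale (a * b) q.
Proof. by rewrite /qscale rmorphM mulrA. Qed.
Fact qscale1 : left_id 1 qscale.
Proof. by move=> q; rewrite /qscale rmorph1 mul1r. Qed.
Fact qscaleDr : right_distributive qscale +%R.
Proof. by move=> a q q'; exact: mulrDr. Qed.
Fact qscaleDl q : {morph qscale^~ q : a b / a + b}.
Proof. by move=> a b; rewrite /qscale rmorphD mulrDl. Qed.

HB.instance Definition _ := GRing.Zmodule_isLmodule.Build R (qmod iota)
  qscaleA qscale1 qscaleDr qscaleDl.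
End Qmod.

Section Realization.
Variables (R : comNzRingType) (iota : {rmorphism R -> rat}).
Hypothesis iota_inj : injective iota.
Local Notation qm := (qmod iota).

Lemma iota_eq0 r : (iota r == 0) = (r == 0).
Proof. by rewrite -(inj_eq iota_inj) rmorph0. Qed.

(** A product of denominators is an integer, and every subring of the rationals contains the
    integers; so [d] can be found in [R]. *)
Lemma clear_denominators (A : eqType) (s : seq A) (u : A -> rat) :
  exists2 d : R, d != 0 & forall a, a \in s -> exists c, iota c = iota d * u a.
Proof.
elim: s => [|a s [d d0 dP]]; first by exists 1; rewrite ?oner_eq0.
exists (d * (denq (u a))%:~R).
  by rewrite -iota_eq0 rmorphM rmorph_int mulf_neq0 ?iota_eq0 // intr_eq0 denq_neq0.
move=> b; rewrite inE => /orP[/eqP ->|/dP[c cE]].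
  exists (d * (numq (u a))%:~R); rewrite !rmorphM !rmorph_int -mulrA.
  by rewrite numqE [u a * _]mulrC.
by exists (c * (denq (u a))%:~R); rewrite !rmorphM cE mulrAC.
Qed.

Definition delta (Z : eqType) (z w : Z) : qm := (w == z)%:R : rat.

Lemma sum_fun_apply (Z : Type) J (r : seq J) (P : pred J) (F : J -> Z -> qm) z :
  (\sum_(j <- r | P j) F j) z = \sum_(j <- r | P j) F j z.
Proof. by apply: (big_morph (fun f : Z -> qm => f z)). Qed.

Lemma scale_fun_apply (Z : Type) r (f : Z -> qm) z :
  (r *: f) z = iota r * (f z : rat) :> rat.
Proof. by []. Qed.

Lemma add_fun_apply (Z : Type) (f g : Z -> qm) z : (f + g) z = f z + g z.
Proof. by []. Qed.

(** For nonzero p_m, the unique solution of p_m y_(m+1) = y_m + c_m with y_0 = e. *)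
Fixpoint yrec (Z : Type) (p : nat -> R) (e : Z -> qm) (c : nat -> Z -> qm) m : Z -> qm :=
  if m is m'.+1 then fun z => ((yrec p e c m' + c m') z : rat) / iota (p m') else e.

Lemma yrecS (Z : Type) p (e : Z -> qm) c m : p m != 0 ->
  p m *: yrec p e c m.+1 = yrec p e c m + c m.
Proof.
move=> pm; apply/funext => z; rewrite [LHS]scale_fun_apply /=.
by rewrite mulrC divfK // iota_eq0.
Qed.

Lemma fun_torsion (Z : Type) r (f : Z -> qm) z : r != 0 -> (r *: f) z = 0 -> f z = 0.
Proof.
move=> r0 /eqP; rewrite scale_fun_apply mulf_eq0 iota_eq0 (negPf r0) /=.
by move/eqP.
Qed.

Section Local.
Variables (n : nat) (p : nat -> R) (k : nat -> nat -> R).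
Hypothesis p0 : forall m, p m != 0.

(** The model of B/N in n+1 rational coordinates: coordinate 0 belongs to y_0, which shifts x_i to
    coordinate i+1. *)
Definition xloc i : nat -> qm := delta i.+1.
Definition yloc := yrec p (delta 0%N) (fun m => \sum_(i < n) k i m *: xloc i).

Lemma yloc_rel : pres_rel n p k xloc yloc.
Proof. by move=> m; exact: yrecS. Qed.

Lemma sum_xloc (a : nat -> R) j :
  (\sum_(i < n) a i *: xloc i) j =
  (if j is j'.+1 then if (j' < n)%N then iota (a j') else 0 else 0) :> rat.
Proof.
rewrite sum_fun_apply; case: j => [|j].
  by rewrite big1 // => i _; rewrite scale_fun_apply mulr0.
case: ltnP => [jn|nj].
  rewrite (bigD1 (Ordinal jn)) //= big1 ?addr0.
    by rewrite scale_fun_apply /xloc /delta eqxx mulr1.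
  move=> i ij; rewrite scale_fun_apply /xloc /delta eqSS.
  by rewrite (_ : (j == i :> nat) = false) ?mulr0 // eq_sym; apply/negbTE.
rewrite big1 // => i _; rewrite scale_fun_apply /xloc /delta eqSS.
by rewrite gtn_eqF ?mulr0 // (leq_trans (ltn_ord i)).
Qed.

(** Each step divides coordinate 0 by p_m and adds only multiples of the x_i, which vanish there. *)
Lemma yloc0 m : yloc m 0%N != 0.
Proof.
elim: m => [|m IH]; first exact: oner_neq0.
rewrite /yloc /= -/yloc add_fun_apply (sum_xloc (fun i => k i m)) addr0 mulf_neq0 //.
by rewrite invr_eq0 iota_eq0.
Qed.

Lemma loc_independent (a : nat -> R) b N :
  \sum_(i < n) a i *: xloc i + b *: yloc N = 0 ->
  b = 0 /\ forall i, (i < n)%N -> a i = 0.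
Proof.
move=> h; have b0 : b = 0.
  have := congr1 (fun f : nat -> qm => f 0%N) h; rewrite add_fun_apply sum_xloc add0r.
  by move/eqP; rewrite scale_fun_apply mulf_eq0 (negPf (yloc0 N)) orbF iota_eq0 => /eqP.
split=> // i lin; have := congr1 (fun f : nat -> qm => f i.+1) h.
rewrite b0 scale0r addr0 sum_xloc lin => /eqP.
by rewrite iota_eq0 => /eqP.
Qed.

Lemma pres_realization (M : lmodType R) (x y : nat -> M) : pres n p k x y ->
  exists psi : M -> nat -> qm, [/\ is_lin psi, injective psi,
    forall i, (i < n)%N -> psi (x i) = xloc i, forall m, psi (y m) = yloc m &
    forall g j, (n < j)%N -> psi g j = 0].
Proof.
move=> pM; have [_ _ _ /(_ _ xloc yloc yloc_rel)[psi lpsi [psix psiy]]] := pM.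
have psinf (a : nat -> R) b N : psi (\sum_(i < n) a i *: x i + b *: y N) =
    \sum_(i < n) a i *: xloc i + b *: yloc N.
  rewrite is_linD // is_linZ // psiy is_lin_sum //; congr (_ + _).
  by apply: eq_bigr => i _; rewrite is_linZ // psix.
exists psi; split=> //.
  move=> g g' gg'; apply/eqP; rewrite -subr_eq0; apply/eqP.
  have : psi (g - g') = 0 by rewrite is_linB // gg' subrr.
  have [N [a [b ->]]] := pres_nf pM (g - g').
  rewrite psinf => /loc_independent[-> a0]; rewrite scale0r addr0 big1 // => i _.
  by rewrite a0 // scale0r.
move=> g j nj; have [N [a [b ->]]] := pres_nf pM g.
rewrite psinf add_fun_apply sum_xloc; case: j nj => // j; rewrite ltnS => nj.
rewrite ltnNge nj add0r scale_fun_apply.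
suff -> : yloc N j.+1 = 0 by rewrite mulr0.
elim: N => [|N IH]; first by rewrite /yloc /= /delta.
by rewrite /yloc /= -/yloc add_fun_apply (sum_xloc (fun i => k i N))
  ltnNge nj addr0 IH mul0r.
Qed.

Lemma pres_rank (M : lmodType R) (x y : nat -> M) n' : pres n p k x y ->
  rank_at_least M n'.+1 -> (n' <= n)%N.
Proof.
move=> pM [s [us ss iS]]; rewrite leqNgt; apply/negP => nn'.
have [psi [lpsi ipsi _ _ psi0]] := pres_realization pM.
(* With n < n' there are more rows than columns, so a nonzero row [u] is killed by [A]; after
   clearing denominators it is a relation over [R] among the elements of [s]. *)
pose A : 'M[rat]_(n'.+1, n.+1) := \matrix_(t, j) psi s`_t j.
have kA : kermx A != 0.
  rewrite -mxrank_eq0 mxrank_ker subn_eq0 -ltnNge.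
  by apply: leq_ltn_trans (rank_leq_col A) _.
have /rowV0Pn[u /sub_kermxP uA u0] := kA.
have [d d0 dP] := clear_denominators (enum 'I_n'.+1) (fun t => u 0 t).
have /choice[c cP] : forall t : 'I_n'.+1, exists c, iota c = iota d * u 0 t.
  by move=> t; apply: dP; rewrite mem_enum.
have c0 : \sum_(j < size s) c (inord j) *: s`_j = 0.
  apply: ipsi; rewrite (is_lin0 lpsi) is_lin_sum // ss; apply/funext => j.
  rewrite sum_fun_apply; have [jn|nj] := ltnP n j.
    by rewrite big1 // => t _; rewrite is_linZ // scale_fun_apply psi0 // mulr0.
  have := congr1 (fun B : 'rV[rat]_n.+1 => iota d * B 0 (inord j)) uA.
  rewrite !mxE mulr0 mulr_sumr => uA0; rewrite -[RHS]uA0; apply: eq_bigr => t _.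
  rewrite is_linZ // scale_fun_apply inord_val cP mulrA; congr (_ * _).
  by rewrite !mxE inordK // ltnS.
have := iS s (fun j => c (inord j)) us (fun j => @mem_nth _ 0 s j) c0.
move=> cz; move: u0; case/negP; apply/eqP/rowP => t.
have := cP t; rewrite mxE -{1}(inord_val t) cz ?ss // rmorph0.
by move/esym/eqP; rewrite mulf_eq0 iota_eq0 (negPf d0) => /eqP.
Qed.

End Local.
End Realization.

(** * Submodules as modules in their own right *)

Section SubmoduleType.
Variables (R : comNzRingType) (V : lmodType R) (S : V -> Prop).

Definition subpred : {pred V} := fun v => `[< S v >].

(** The proof [sS] is a parameter of the type, so that the module structure can be inferred from the
    type alone. *)
Record submod (sS : submodule S) := Submod { subval : V; _ : subval \in subpred }.

Variable sS : submodule S.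
HB.instance Definition _ := [isSub of submod sS for @subval sS].
HB.instance Definition _ := [Choice of submod sS by <:].

Fact subpred_closed : submod_closed subpred.
Proof.
split=> [|a u v]; first by apply/asboolP; case: sS.
by move=> /asboolP Su /asboolP Sv; apply/asboolP/sS.2.
Qed.

HB.instance Definition _ :=
  GRing.SubChoice_isSubLmodule.Build R V subpred (submod sS) subpred_closed.

Lemma submod_valP (u : submod sS) : S (val u).
Proof. by have /asboolP := valP u. Qed.

Definition to_submod v (Sv : S v) : submod sS := Submod sS (introT (asboolP _) Sv).

Lemma is_lin_val : is_lin (val : submod sS -> V).
Proof. by []. Qed.

End SubmoduleType.

(** * Independence and submodules of finite rank *)

Section Independence.
Variables (R : comNzRingType) (M : lmodType R).
Implicit Types B C S : M -> Prop.

Lemma span_in_uniq C v : span_in C v -> exists (s : seq M) (c : M -> R),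
  [/\ uniq s, forall x, x \in s -> C x & v = \sum_(x <- s) c x *: x].
Proof.
move=> /span_inP[s [sC ->]].
exists (undup [seq z.2 | z <- s]), (fun x => \sum_(z <- s | z.2 == x) z.1).
split=> [|x|]; first exact: undup_uniq.
  by rewrite mem_undup => /mapP[z zs ->]; exact: sC.
under [RHS]eq_bigr => x _ do rewrite scaler_suml.
under [RHS]eq_bigr => x _ do rewrite big_mkcond.
rewrite exchange_big /=; apply: eq_big_seq => z zs.
rewrite (bigD1_seq z.2) ?undup_uniq ?mem_undup ?map_f //= eqxx big1 ?addr0 //.
by move=> x; rewrite eq_sym => /negPf ->.
Qed.

(** Since [x] does not occur in the combination of elements of [C], moving it to the side of d x
    gives a relation among distinct elements of [B]. This yields the maximality clause of
    [rank_is]. *)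
Lemma independent_span B C x d : independent B -> (forall y, C y -> B y) ->
  B x -> ~ C x -> span_in C (d *: x) -> d = 0.
Proof.
move=> /independentP iB CB Bx nCx /span_in_uniq[s [c [us sC dx]]].
have xs : x \notin s by apply/negP => /sC.
have := iB (x :: s) (fun y => if y == x then d else - c y).
move=> /(_ _ _ _ x (mem_head _ _)); rewrite eqxx; apply.
- by rewrite /= xs us.
- by move=> y; rewrite inE => /orP[/eqP -> //|/sC/CB].
rewrite big_cons eqxx dx -big_split big_seq big1 //= => y ys.
by rewrite ifN ?scaleNr ?subrr //; apply: contraNneq xs => <-.
Qed.

(** The rank bounds the length of independent sequences, so a longest one exists; an element of [S]
    with no nonzero multiple in its span could be added to it. *)
Lemma rank_at_most_span S n : submodule S -> rank_at_most S n ->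
  exists s : seq M, (forall x, x \in s -> S x) /\
    forall x, S x -> exists2 d : R, d != 0 & span_in (fun y => y \in s) (d *: x).
Proof.
move=> sS rS; pose P m := `[< exists s : seq M, [/\ uniq s,
  forall x, x \in s -> S x, independent (fun x => x \in s) & size s = m] >].
have exP : exists m, P m.
  by exists 0%N; apply/asboolP; exists [::]; split=> // s c _ sn _ j /sn.
have Pn m : P m -> (m <= n)%N.
  by move=> /asboolP[s [us sS' iS <-]]; exact: rS.
case: (ex_maxnP exP Pn) => m /asboolP[s [us sS' iS sm]] mmax.
exists s; split=> // x Sx.
have [xs|xs] := boolP (x \in s).
  by exists 1; rewrite ?oner_neq0 // scale1r; exact: span_in_mem.
have : ~ independent (fun y => y \in x :: s).
  move=> iS'; have : (m.+1 <= m)%N; last by rewrite ltnn.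
  apply: mmax; apply/asboolP; exists (x :: s); split=> //=; last by rewrite sm.
    by rewrite xs us.
  by move=> y; rewrite inE => /orP[/eqP ->|/sS'].
move=> nS; apply: contrapT => nd; apply: nS; apply/independentP => t c ut ts tc0.
have sp : submodule (span_in (fun y => y \in s)) by exact: span_in_submodule.
have spt (u : seq M) : {subset u <= t} -> x \notin u ->
    span_in (fun y => y \in s) (\sum_(y <- u) c y *: y).
  move=> ut' xu; rewrite big_seq; apply: submodule_sum => // y yu.
  apply: submoduleZ => //; apply: span_in_mem.
  have := ts y (ut' y yu); rewrite inE => /orP[/eqP yx|//].
  by rewrite yx (negPf xu) in yu.
have cx : x \in t -> c x = 0.
  move=> xt; apply: contrapT => /eqP cx0; apply: nd; exists (c x) => //.
  move: tc0; rewrite (bigD1_seq x) //= => /eqP; rewrite addr_eq0 => /eqP ->.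
  apply: submoduleN => //; rewrite -big_filter; apply: spt.
    by move=> y; rewrite mem_filter => /andP[].
  by rewrite mem_filter eqxx.
have /independentP/(_ [seq y <- t | y != x] c) h := iS.
move=> y yt; have [yx|yx] := eqVneq y x; first by rewrite yx cx // -yx.
apply: h; rewrite ?filter_uniq //.
- by move=> z; rewrite mem_filter => /andP[zx /ts]; rewrite inE (negPf zx).
- rewrite big_filter -[RHS]tc0 big_mkcond; apply: eq_big_seq => z zt.
  by case: eqVneq => //= zx; rewrite zx cx ?scale0r // -zx.
- by rewrite mem_filter yx.
Qed.

End Independence.

(** * The module spanned by a well-ordered family of generators *)

Section Tower.
Variables (R : comNzRingType) (iota : {rmorphism R -> rat}).
Hypothesis iota_inj : injective iota.
Local Notation qm := (qmod iota).
Variables (I : Type) (Phi : I -> lmodType R).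
Variables (n : I -> nat) (p : I -> nat -> R) (k : I -> nat -> nat -> R).
Variables (px py : forall i, nat -> Phi i).
Hypothesis presP : forall i, pres (n i) (p i) (k i) (px i) (py i).
Variables (T : eqType) (lt : T -> T -> Prop).
Hypothesis lt_trans : forall a b c, lt a b -> lt b c -> lt a c.
Hypothesis lt_irr : forall a, ~ lt a a.
Hypothesis lt_total : forall a b, a = b \/ lt a b \/ lt b a.
Hypothesis lt_wf : well_founded lt.
Local Notation V := (T * nat -> qm).
Variables (idx : T -> I) (Y rhs : T -> nat -> V).

Definition gx (v : T) j : V := delta iota (v, j.+1).

(** One term is attached at a time, so that a derivation can be read back as the list of terms that
    a node stores. *)
Inductive gspan (P : T -> Prop) : V -> Prop :=
| gspan0 : gspan P 0
| gspanX r v j w : P v -> (j < n (idx v))%N -> gspan P w -> gspan P (r *: gx v j + w)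
| gspanY r v m w : P v -> gspan P w -> gspan P (r *: Y v m + w).

Hypothesis Y0 : forall v, Y v 0%N = delta iota (v, 0%N).
Hypothesis YS : forall v m, p (idx v) m *: Y v m.+1 =
  Y v m + \sum_(j < n (idx v)) k (idx v) j m *: gx v j + rhs v m.
Hypothesis rhs_span : forall v m, gspan (lt^~ v) (rhs v m).
Hypothesis rhs_surj : forall i (g : nat -> V), (forall m, gspan (fun=> True) (g m)) ->
  exists v, idx v = i /\ forall m, rhs v m = g m.

Let p0 i m : p i m != 0. Proof. by case: (presP i). Qed.

Definition le a b := a = b \/ lt a b.

Lemma gspan_submodule P : submodule (gspan P).
Proof.
have gD u w : gspan P u -> gspan P w -> gspan P (u + w).
  by move=> gu gw; elim: gu => [|r v j u' Pv jn _ IH|r v m u' Pv _ IH];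
     rewrite ?add0r // -addrA; [exact: gspanX|exact: gspanY].
split=> [|a u w gu gw]; first exact: gspan0.
apply: gD => //; elim: gu => [|r v j u' Pv jn _ IH|r v m u' Pv _ IH];
  rewrite ?scaler0 ?scalerDr ?scalerA; [exact: gspan0|exact: gspanX|exact: gspanY].
Qed.

Lemma gspan_min P (S : V -> Prop) : submodule S ->
  (forall v j, P v -> (j < n (idx v))%N -> S (gx v j)) ->
  (forall v m, P v -> S (Y v m)) -> forall w, gspan P w -> S w.
Proof.
move=> sS SX SY w; elim=> [|r v j u' Pv jn _ IH|r v m u' Pv _ IH].
- exact: submodule0.
- by apply: sS.2 => //; exact: SX.
- by apply: sS.2 => //; exact: SY.
Qed.

Lemma gspan_X (P : T -> Prop) v j : P v -> (j < n (idx v))%N -> gspan P (gx v j).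
Proof.
move=> Pv jn; rewrite -[gx v j]scale1r -[_ *: _]addr0.
by apply: gspanX => //; exact: gspan0.
Qed.

Lemma gspan_Y (P : T -> Prop) v m : P v -> gspan P (Y v m).
Proof.
move=> Pv; rewrite -[Y v m]scale1r -[_ *: _]addr0.
by apply: gspanY => //; exact: gspan0.
Qed.

Lemma gspan_sub (P Q : T -> Prop) w : (forall v, P v -> Q v) -> gspan P w -> gspan Q w.
Proof.
move=> PQ; apply: gspan_min => [|v j /PQ Qv jn|v m /PQ Qv].
- exact: gspan_submodule.
- exact: gspan_X.
- exact: gspan_Y.
Qed.

(* The generators all lie in the pure closure of the span of the delta's. *)
Lemma gspan_pure (P : T -> Prop) (S : V -> Prop) :
  submodule S -> (forall r w, r != 0 -> S (r *: w) -> S w) ->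
  (forall a b, P b -> lt a b -> P a) ->
  (forall v j, P v -> (j <= n (idx v))%N -> S (delta iota (v, j))) ->
  forall w, gspan P w -> S w.
Proof.
move=> sS pS dP SD; apply: gspan_min => //; first by move=> v j Pv jn; exact: SD.
(* Induction on the node and, inside it, on m: the relation puts p_m Y_(m+1) into [S], and purity
   cancels p_m. *)
elim/(well_founded_ind lt_wf) => v IH m Pv.
elim: m => [|m IHm]; first by rewrite Y0; exact: SD.
apply: (pS _ _ (p0 (idx v) m)); rewrite YS.
apply: (submoduleD sS).
  apply: (submoduleD sS) => //; apply: (submodule_sum sS) => j _.
  by apply: (submoduleZ sS); apply: SD.
apply: gspan_min (rhs_span v m) => // [u j uv jn|u m' uv].
  exact: (SD u j.+1 (dP _ _ Pv uv)).
by apply: IH => //; exact: dP uv.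
Qed.

Definition supp (Q : T * nat -> Prop) (w : V) := forall z, w z != 0 -> Q z.

Lemma supp_submodule Q : submodule (supp Q).
Proof.
split=> [z|r u w su sw z]; first by rewrite eqxx.
rewrite add_fun_apply scale_fun_apply => h.
have [/eqP uz0|/su//] := boolP (u z == 0).
by apply: sw; move: h; rewrite uz0 mulr0 add0r.
Qed.

Lemma supp_pure Q r w : r != 0 -> supp Q (r *: w) -> supp Q w.
Proof.
move=> r0 h z wz; apply: h; rewrite scale_fun_apply mulf_neq0 //.
by rewrite iota_eq0.
Qed.

Lemma supp_sub (P Q : T * nat -> Prop) w : (forall z, P z -> Q z) -> supp P w -> supp Q w.
Proof. by move=> PQ h z /h/PQ. Qed.

Lemma supp_delta (Q : T * nat -> Prop) z : Q z -> supp Q (delta iota z).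
Proof. by move=> Qz w; rewrite /delta; have [->//|_] := eqVneq w z; rewrite eqxx. Qed.

Lemma gspan_supp (P : T -> Prop) w : (forall a b, P b -> lt a b -> P a) ->
  gspan P w -> supp (fun z => P z.1) w.
Proof.
move=> dP; apply: (@gspan_pure P (supp (fun z => P z.1))) => //.
  exact: supp_submodule.
  by move=> r u; exact: supp_pure.
by move=> v j Pv _; exact: supp_delta.
Qed.

Lemma gspan_fsupp w : gspan (fun=> True) w -> exists l : seq (T * nat),
  supp (fun z => z \in l) w.
Proof.
apply: (@gspan_pure (fun=> True) (fun w => exists l, supp (fun z => z \in l) w)) => //.
- split=> [|r u v [l lu] [l' lv]]; first by exists [::] => z; rewrite eqxx.
  exists (l ++ l'); apply: (supp_submodule _).2.
    by apply: supp_sub lu => z zl; rewrite mem_cat zl.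
  by apply: supp_sub lv => z zl; rewrite mem_cat zl orbT.
- by move=> r v r0 [l /(supp_pure r0) lv]; exists l.
- by move=> v j _ _; exists [:: (v, j)]; apply: supp_delta; rewrite mem_head.
Qed.

Lemma le_or_lt a b : le a b \/ lt b a.
Proof. by rewrite /le; have [->|[]] := lt_total a b; auto. Qed.

Lemma le_lt a b c : le a b -> lt b c -> lt a c.
Proof. by case=> [->//|/lt_trans]; apply. Qed.

Lemma le_trans a b c : le a b -> le b c -> le a c.
Proof. by move=> ab [<- //|bc]; right; exact: le_lt bc. Qed.

Lemma le_down c a b : le b c -> lt a b -> le a c.
Proof. by move=> bc ab; right; case: bc ab => [-> //|bc ab]; exact: lt_trans bc. Qed.

Lemma seq_max (l : seq T) : l != [::] ->
  exists2 c, c \in l & forall b, b \in l -> le b c.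
Proof.
elim: l => // a l IH _; have [->|/IH[c cl cmax]] := eqVneq l [::].
  by exists a; rewrite ?mem_head // => b; rewrite inE => /eqP ->; left.
have [ac|ca] := le_or_lt a c.
  by exists c; rewrite ?inE ?cl ?orbT // => b /orP[/eqP -> //|/cmax].
exists a; rewrite ?mem_head // => b; rewrite inE => /orP[/eqP ->|/cmax bc].
  by left.
by right; exact: le_lt ca.
Qed.

Lemma supp_max w : gspan (fun=> True) w -> w = 0 \/
  exists2 z, w z != 0 & supp (fun z' => le z'.1 z.1) w.
Proof.
move=> /gspan_fsupp[l lw]; pose l' := [seq z.1 | z <- l & w z != 0].
have [l0|/seq_max[c /mapP[z + ->] cmax]] := eqVneq l' [::].
  left; apply/funext => z; apply/eqP; rewrite -[_ == _]negbK; apply/negP => wz.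
  have : z.1 \in l' by apply: map_f; rewrite mem_filter wz; exact: lw.
  by rewrite l0.
rewrite mem_filter => /andP[wz _]; right; exists z => // z' wz'.
by apply: cmax; apply: map_f; rewrite mem_filter wz'; exact: lw.
Qed.

Lemma gspan_max P w : gspan P w ->
  w = 0 \/ exists2 a, P a & gspan (le^~ a) w.
Proof.
pose S w := w = 0 \/ exists2 a, P a & gspan (le^~ a) w.
have gle a b w' : le a b -> gspan (le^~ a) w' -> gspan (le^~ b) w'.
  by move=> ab; apply: gspan_sub => c ca; exact: le_trans ab.
have gS a w' : P a -> gspan (le^~ a) w' -> S w' by move=> Pa ga; right; exists a.
apply: (@gspan_min P S) => [|v j Pv jn|v m Pv]; last 2 first.
- by apply: (gS v) => //; apply: gspan_X => //; left.
- by apply: (gS v) => //; apply: gspan_Y; left.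
split=> [|r u v]; first by left.
case=> [->|[a Pa ga]]; first by rewrite scaler0 add0r.
case=> [->|[b Pb gb]].
  by rewrite addr0; apply: (gS a) => //; apply: (submoduleZ (gspan_submodule _)).
have [ab|ba] := le_or_lt a b.
  by apply: (gS b) => //; apply: (gspan_submodule _).2 => //; exact: gle ga.
by apply: (gS a) => //; apply: (gspan_submodule _).2 => //; apply: gle gb; right.
Qed.

Definition loc v (w : V) : nat -> qm := fun j => w (v, j).

Lemma is_lin_loc v : is_lin (loc v). Proof. by []. Qed.

Lemma loc_gx v j : loc v (gx v j) = xloc iota j.
Proof.
apply/funext => i; rewrite /loc /gx /xloc /delta; congr (nat_of_bool _)%:R.
by rewrite xpair_eqE eqxx.
Qed.

Lemma supp_lt_loc v w : supp (fun z => lt z.1 v) w -> loc v w = 0.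
Proof.
move=> sw; apply/funext => j; apply/eqP; rewrite -[_ == _]negbK; apply/negP.
by move=> /sw /lt_irr.
Qed.

Lemma loc_lt v w : gspan (lt^~ v) w -> loc v w = 0.
Proof.
move=> /gspan_supp sw; apply: supp_lt_loc; apply: sw => a b bv ab.
exact: lt_trans bv.
Qed.

Local Notation yl v := (yloc iota (n (idx v)) (p (idx v)) (k (idx v))).

(** The right-hand sides come from smaller nodes and have no coordinate at [v], so at [v] the
    relations are those of the local model, which has only one solution. *)
Lemma loc_Y v m : loc v (Y v m) = yl v m.
Proof.
elim: m => [|m IH].
  apply/funext => i; rewrite Y0 /loc /yloc /= /delta; congr (nat_of_bool _)%:R.
  by rewrite xpair_eqE eqxx.
have h : p (idx v) m *: loc v (Y v m.+1) = p (idx v) m *: yl v m.+1.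
  have lv := is_lin_loc v.
  rewrite (yloc_rel iota_inj _ _ (p0 (idx v))) -(is_linZ _ _ lv) YS !(is_linD _ _ lv).
  rewrite IH (loc_lt (rhs_span v m)) addr0 (is_lin_sum _ _ _ lv).
  by congr (_ + _); apply: eq_bigr => j _; rewrite (is_linZ _ _ lv) loc_gx.
apply/eqP; rewrite -subr_eq0; apply/eqP; apply/funext => j.
by apply: (fun_torsion iota_inj (p0 (idx v) m)); rewrite scalerBr h subrr.
Qed.

Lemma loc_nf v (a : nat -> R) b N :
  loc v (\sum_(i < n (idx v)) a i *: gx v i + b *: Y v N) =
  \sum_(i < n (idx v)) a i *: xloc iota i + b *: yl v N.
Proof.
have lv := is_lin_loc v.
rewrite (is_linD _ _ lv) (is_linZ _ _ lv) loc_Y (is_lin_sum _ _ _ lv); congr (_ + _).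
by apply: eq_bigr => i _; rewrite (is_linZ _ _ lv) loc_gx.
Qed.

Lemma gspan_nf v w : gspan (le^~ v) w ->
  exists N, nf (n (idx v)) (gspan (lt^~ v)) (gx v) (Y v) N w.
Proof.
have sl := gspan_submodule (lt^~ v).
have snf N := nf_submodule (n (idx v)) (gx v) (Y v) sl N.
(* The claim is made for all large N because a sum of two elements needs one N that serves both. *)
suff h : gspan (le^~ v) w -> exists N0, forall N, (N0 <= N)%N ->
    nf (n (idx v)) (gspan (lt^~ v)) (gx v) (Y v) N w.
  by move=> /h[N0 /(_ N0 (leqnn _))]; exists N0.
apply: (@gspan_min (le^~ v) (fun w => exists N0, forall N, (N0 <= N)%N ->
    nf (n (idx v)) (gspan (lt^~ v)) (gx v) (Y v) N w)).
- split=> [|r u u' [N1 h1] [N2 h2]]; first by exists 0%N => N _; apply: submodule0.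
  exists (maxn N1 N2) => N; rewrite geq_max => /andP[n1 n2].
  by apply: (snf N).2; [exact: h1|exact: h2].
- move=> u j [-> jn|uv jn]; exists 0%N => N _; first exact: nfX.
  by apply: nf_base => //; exact: gspan_X.
- move=> u m [->|uv]; last by exists 0%N => N _; apply: nf_base => //; exact: gspan_Y.
  exists m => N mN; apply: (nfY (p := p (idx v)) (k := k (idx v))) => // m'.
  by rewrite YS addrAC subrr add0r; exact: rhs_span.
Qed.

(** In the normal form, [loc v] sees the contribution of [v] faithfully and the rest not at all;
    where [loc v w] vanishes, so do the coefficients at [v]. *)
Lemma gspan_drop v w : gspan (le^~ v) w -> loc v w = 0 -> gspan (lt^~ v) w.
Proof.
move=> /gspan_nf[N [a [b h]]] w0.
have := loc_lt h; rewrite (is_linB _ _ (is_lin_loc v)) w0 sub0r loc_nf => /eqP.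
rewrite oppr_eq0 => /eqP /(loc_independent iota_inj (p0 (idx v)))[b0 a0].
move: h; rewrite b0 scale0r addr0 big1 ?subr0 // => i _.
by rewrite a0 // scale0r.
Qed.

(** Descent on a node b that bounds the generators in use: while b exceeds [a], the coordinates at b
    vanish, [gspan_drop] removes b and [gspan_max] supplies a smaller bound. Thus the filtration by
    supports, for which continuity is plain, agrees with the one by generators, which the quotients
    require. *)
Lemma gspan_supp_le a w : gspan (fun=> True) w -> supp (fun z => le z.1 a) w ->
  gspan (le^~ a) w.
Proof.
move=> gw sw; have [->|[b _]] := gspan_max gw; first exact: gspan0.
elim/(well_founded_ind lt_wf): b => b IH gb.
have [ba|ab] := le_or_lt b a; first by apply: gspan_sub gb => c cb; exact: le_trans ba.
have /(gspan_drop gb) : loc b w = 0.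
  apply: supp_lt_loc; apply: supp_sub sw => z za; exact: le_lt ab.
by case/gspan_max => [->|[c cb gc]]; [exact: gspan0|exact: IH gc].
Qed.

Definition tower : lmodType R := submod (gspan_submodule (fun=> True)).
Local Notation G := tower.

Definition below (P : T -> Prop) (x : G) := supp (fun z => P z.1) (val x).

Lemma below_submodule P : submodule (below P).
Proof.
split=> [|r x y]; first exact: submodule0 (supp_submodule _).
exact: (supp_submodule _).2.
Qed.

(** On elements supported up to [a], the map [loc a] kills exactly those supported strictly below
    [a], and its values form the copy of [Phi (idx a)] given by [psi]. The required map is [loc a]
    followed by the inverse of [psi]. *)
Lemma tower_quot a : quot_iso (below (le^~ a)) (below (lt^~ a)) (Phi (idx a)).
Proof.
have [psi [lpsi ipsi psix psiy _]] :=
  pres_realization iota_inj (p0 (idx a)) (presP (idx a)).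
have ex (x : G) : exists z, below (le^~ a) x -> psi z = loc a (val x).
  have [bx|nx] := pselect (below (le^~ a) x); last by exists 0.
  suff [z zE] : exists z, psi z = loc a (val x) by exists z.
  have := gspan_supp_le (submod_valP x) bx.
  apply: (@gspan_min _ (fun w => exists z, psi z = loc a w)).
  - split=> [|r u w [z zE] [z' z'E]].
      by exists 0; rewrite (is_lin0 lpsi) (is_lin0 (is_lin_loc a)).
    by exists (r *: z + z'); rewrite lpsi is_lin_loc zE z'E.
  - move=> v j [-> jn|va jn]; first by exists (px (idx a) j); rewrite psix // loc_gx.
    by exists 0; rewrite (is_lin0 lpsi) loc_lt //; exact: gspan_X.
  - move=> v m [->|va]; first by exists (py (idx a) m); rewrite psiy // loc_Y.
    by exists 0; rewrite (is_lin0 lpsi) loc_lt //; exact: gspan_Y.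
have [phi phiP] := choice ex.
exists phi; split.
- move=> r x y bx byy; apply: ipsi; rewrite lpsi !phiP //.
  exact: (below_submodule _).2.
- move=> z; have [N [c [b ->]]] := pres_nf (presP (idx a)) z.
  have gw : gspan (le^~ a) (\sum_(i < n (idx a)) c i *: gx a i + b *: Y a N).
    apply: (submoduleD (gspan_submodule _)).
      apply: (submodule_sum (gspan_submodule _)) => i _.
      by apply: (submoduleZ (gspan_submodule _)); apply: gspan_X => //; left.
    by apply: (submoduleZ (gspan_submodule _)); apply: gspan_Y; left.
  pose x : G := to_submod (gspan_submodule _) (gspan_sub (fun _ _ => Logic.I) gw).
  have bx : below (le^~ a) x by apply: (gspan_supp _ gw) => u v; exact: le_down.
  exists x; split=> //; apply: ipsi; rewrite phiP // loc_nf.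
  rewrite (is_linD _ _ lpsi) (is_linZ _ _ lpsi) psiy (is_lin_sum _ _ _ lpsi).
  congr (_ + _).
  by apply: eq_bigr => i _; rewrite (is_linZ _ _ lpsi) psix.
- move=> x bx; split=> [px0|lx]; last first.
    by apply: ipsi; rewrite phiP // supp_lt_loc // (is_lin0 lpsi).
  have lx : loc a (val x) = 0 by rewrite -phiP // px0 (is_lin0 lpsi).
  move=> [v j] wz; case: (bx _ wz) => //= va; move: wz; rewrite va.
  by have := congr1 (@^~ j) lx; rewrite /loc => ->; rewrite eqxx.
Qed.

Lemma tower_torsion_free : torsion_free G.
Proof.
move=> r x rx; have [->|r0] := eqVneq r 0; [by left|right].
apply: val_inj; apply/funext => z; apply: (fun_torsion iota_inj r0).
by rewrite -(is_linZ r x (@is_lin_val _ _ _ _)) rx.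
Qed.


(** Stage [Some a] will hold the elements supported strictly below [a]. The adjoined top [None]
    makes the whole module a stage and gives a successor even to a last node. *)
Definition ltO (a b : option T) : Prop :=
  match a, b with
  | Some a, Some b => lt a b
  | Some _, None => True
  | None, _ => False
  end.

Lemma ltO_wf : well_founded ltO.
Proof.
have aS a : Acc ltO (Some a).
  elim/(well_founded_ind lt_wf): a => a IH; constructor=> -[b ba|[]].
  exact: (IH b ba).
by case=> [a|]; [exact: aS|constructor=> -[b _|[]]; exact: aS].
Qed.

Lemma tower_represented : Phi_represented Phi G.
Proof.
exists (option T), ltO, (fun a => below (fun v => ltO (Some v) a)).
split; [split|split; [split|split; [|split]]].
- by move=> [a|] [b|] [c|] //=; exact: lt_trans.
- by move=> [a|] //=; exact: lt_irr.
- move=> [a|] [b|] /=; [|by right; left|by right; right|by left].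
  by have [->|[]] := lt_total a b; [left|right; left|right; right].
- exact: ltO_wf.
- by move=> a; exact: below_submodule.
- move=> [a|] [b|] //= ab x; apply: supp_sub => z //= za; exact: lt_trans ab.
- move=> a amin x; split=> [bx|->]; last exact: submodule0 (below_submodule _).
  apply: val_inj; apply/funext => z; apply/eqP; rewrite -[_ == _]negbK.
  by apply/negP => /bx /amin.
- move=> a [b0 b0a] alim x; split=> [bx|[b [ba]]]; last first.
    apply: supp_sub => z zb.
    case: b zb ba => [b|] //=; case: a {b0a alim} => [a|] //=; exact: lt_trans.
  have [x0|[z xz xmax]] := supp_max (submod_valP x).
    exists b0; split=> //.
    by rewrite (_ : x = 0); [exact: submodule0 (below_submodule _)|exact: val_inj].
  (* By [alim], [a] does not directly follow the greatest node in the support of [x]; a stage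
     strictly between them already contains [x]. *)
  have [d [zd da]] : exists d, ltO (Some z.1) d /\ ltO d a.
    apply: contrapT => nd; apply: alim; exists (Some z.1); split; first exact: bx.
    by move=> c [zc ca]; apply: nd; exists c.
  exists d; split=> // z' /xmax z'z.
  by case: d zd {da} => [d|] //=; exact: le_lt.
- move=> x; exists None; move=> z _; exact: Logic.I.
- move=> [a|] b //= ab nab; left; exists (idx a).
  have [phi [phil phis phik]] := tower_quot a.
  have Gb x : below (fun v => ltO (Some v) b) x <-> below (le^~ a) x.
    split; apply: supp_sub => z zb.
      by have [//|az] := le_or_lt z.1 a; exfalso; apply: (nab (Some z.1)).
    by case: b ab {nab} => [b|] //= ab; exact: le_lt ab.
  exists phi; split.
  + by move=> r x y /Gb bx /Gb byy; exact: phil.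
  + by move=> z; have [x [bx <-]] := phis z; exists x; split=> //; apply/Gb.
  + by move=> x /Gb bx; exact: phik.
Qed.

(** Lifts of the generators to [E] violate the relations by errors [h] lying in [G]. A node with
    right-hand sides [h] provides elements of [G] with the same errors; subtracting their images
    corrects the lifts, and the universal property in [pres] turns these into a section. *)
Lemma tower_complete : Phi_complete Phi G.
Proof.
move=> i E f g lf lg fi gs gk.
have [_ rel _ _] := presP i.
have [ex exP] := choice (fun j => gs (px i j)).
have [ey eyP] := choice (fun m => gs (py i m)).
have /choice[h hP] : forall m, exists l,
    f l = p i m *: ey m.+1 - (ey m + \sum_(j < n i) k i j m *: ex j).
  move=> m; apply/gk; rewrite (is_linB _ _ lg) (is_linD _ _ lg) (is_linZ _ _ lg).
  rewrite (is_lin_sum _ _ _ lg) !eyP.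
  rewrite rel; apply/eqP; rewrite subr_eq0; apply/eqP; congr (_ + _).
  by apply: eq_bigr => j _; rewrite (is_linZ _ _ lg) exP.
have [v [vi vh]] := @rhs_surj i (fun m => val (h m)) (fun m => submod_valP (h m)).
subst i.
pose gX j : G := if pselect (j < n (idx v))%N is left jn then
  to_submod (gspan_submodule _) (@gspan_X (fun=> True) v j Logic.I jn) else 0.
pose gY m : G := to_submod (gspan_submodule _) (@gspan_Y (fun=> True) v m Logic.I).
have relG m : p (idx v) m *: gY m.+1 =
    gY m + \sum_(j < n (idx v)) k (idx v) j m *: gX j + h m.
  apply: val_inj; have lv := @is_lin_val _ _ _ (gspan_submodule (fun=> True)).
  rewrite (is_linZ _ _ lv) !(is_linD _ _ lv) (is_lin_sum _ _ _ lv) -vh [LHS]YS.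
  congr (_ + _ + _); apply: eq_bigr => j _; rewrite (is_linZ _ _ lv); congr (_ *: _).
  by rewrite /gX; case: pselect.
have [_ _ _ /(_ E (fun j => ex j - f (gX j)) (fun m => ey m - f (gY m)))] := presP (idx v).
case=> [m|s ls [sx sy]].
  have fh : f (h m) = p (idx v) m *: f (gY m.+1) -
      (f (gY m) + \sum_(j < n (idx v)) k (idx v) j m *: f (gX j)).
    rewrite -(is_linZ _ _ lf) relG !(is_linD _ _ lf) (is_lin_sum _ _ _ lf) addrAC.
    rewrite (eq_bigr (fun j : 'I_(n (idx v)) => k (idx v) j m *: f (gX j)))
      ?subrr ?add0r //.
    by move=> j _; rewrite (is_linZ _ _ lf).
  have -> : \sum_(j < n (idx v)) k (idx v) j m *: (ex j - f (gX j)) =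
     \sum_(j < n (idx v)) k (idx v) j m *: ex j -
     \sum_(j < n (idx v)) k (idx v) j m *: f (gX j).
    by rewrite -sumrB; apply: eq_bigr => j _; rewrite scalerBr.
  rewrite addrACA -opprD scalerBr.
  have alg (a b c d : E) : a - b = c - d -> c - a = d - b.
    by move=> /eqP; rewrite subr_eq => /eqP ->;
      rewrite opprD opprB addrA addrCA subrr addr0.
  by apply: alg; rewrite -fh hP.
exists s; split=> // z.
have gf l : g (f l) = 0 by apply/gk; exists l.
have [N [a [b ->]]] := pres_nf (presP (idx v)) z.
have lgs : is_lin (g \o s) by move=> r u w /=; rewrite ls lg.
rewrite -[g _]/((g \o s) _) (is_linD _ _ lgs) (is_linZ _ _ lgs)
  (is_lin_sum _ _ _ lgs) /=.
rewrite sy (is_linB _ _ lg) gf subr0 eyP; congr (_ + _); apply: eq_bigr => j _.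
by rewrite (is_linZ _ _ ls) (is_linZ _ _ lg) sx // (is_linB _ _ lg) gf subr0 exP.
Qed.

(** A maximal independent set is formed by the [delta] at the positions that [e] lists, n+1 for each
    node with n its number of x_j. Maximality rests on [gspan_pure]: the vectors with a nonzero
    multiple in their span form a pure submodule. *)
Lemma tower_rank (K : Type) (e : K -> T * nat) : injective e ->
  (forall z, (z.2 <= n (idx z.1))%N <-> exists a, e a = z) -> rank_is G K.
Proof.
move=> einj eP.
have gd a : gspan (fun=> True) (delta iota (e a)).
  have := (eP (e a)).2 (ex_intro _ a erefl); case: (e a) => v [|j] /= jn.
    by rewrite -Y0; exact: gspan_Y.
  exact: gspan_X.
pose f a : G := to_submod (gspan_submodule _) (gd a).
have fE a z : (val (f a) : V) z = (z == e a)%:R :> rat by [].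
have finj : injective f.
  move=> a b fab; apply: einj; have := fE a (e a); rewrite fab fE eqxx.
  by case: eqVneq => // _ /eqP; rewrite eq_sym oner_eq0.
exists f; split=> //.
  apply/independentP => s c us sf sc0 x xs; have [a xa] := sf x xs.
  have := congr1 (fun w : G => (val w : V) (e a)) sc0.
  rewrite (is_lin_sum _ _ _ (@is_lin_val _ _ _ _)) sum_fun_apply (bigD1_seq x) //.
  rewrite big_seq_cond big1 ?addr0 => [cx0|y /andP[ys yx]].
    apply/eqP; rewrite -(iota_eq0 iota_inj); apply/eqP; move: cx0.
    rewrite (is_linZ _ _ (@is_lin_val _ _ _ _)) scale_fun_apply -xa fE eqxx mulr1.
    by move=> h; rewrite -[LHS]addr0; exact: h.
  have [b yb] := sf y ys.
  rewrite (is_linZ _ _ (@is_lin_val _ _ _ _)) scale_fun_apply -yb fE.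
  rewrite (_ : (e a == e b) = false) ?mulr0 //; apply/negbTE.
  by apply: contraNneq yx => /einj ab; rewrite -yb -xa ab.
move=> B iB Bf x Bx; apply: contrapT => nx.
pose C (w : G) := exists a, f a = w.
suff [d d0 dx] : exists2 d : R, d != 0 & span_in C (d *: x).
  have := independent_span iB _ Bx nx dx.
  by move=> h; move: d0; rewrite h ?eqxx // => _ [a <-].
suff h w : gspan (fun=> True) w -> exists2 d : R, d != 0 &
    exists2 y : G, val y = d *: w & span_in C y.
  have [d d0 [y yE sy]] := h _ (submod_valP x).
  exists d => //; rewrite (_ : d *: x = y) //; apply: val_inj.
  by rewrite yE (is_linZ _ _ (@is_lin_val _ _ _ _)).
have sC := span_in_submodule C.
apply: (@gspan_pure (fun=> True) (fun w => exists2 d : R, d != 0 &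
    exists2 y : G, val y = d *: w & span_in C y)) => //.
- split=> [|r u u' [d d0 [y yE sy]] [d' d'0 [y' y'E sy']]].
    by exists 1; rewrite ?oner_neq0 //; exists 0; [rewrite scaler0|exact: submodule0].
  exists (d * d'); first by rewrite -(iota_eq0 iota_inj) rmorphM mulf_neq0 ?iota_eq0.
  exists ((r * d') *: y + d *: y'); last by apply: sC.2 => //; exact: submoduleZ.
  rewrite is_lin_val yE (is_linZ _ _ (@is_lin_val _ _ _ _)) y'E scalerDr !scalerA.
  by congr (_ *: _ + _ ); rewrite mulrC [r * d']mulrC mulrA.
- move=> r u r0 [d d0 [y yE sy]]; exists (d * r).
    by rewrite -(iota_eq0 iota_inj) rmorphM mulf_neq0 ?iota_eq0.
  by exists y; rewrite // yE scalerA.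
- move=> v j _ jn; exists 1; first exact: oner_neq0.
  have [a av] := (eP (v, j)).1 jn; exists (f a); last by apply: span_in_mem; exists a.
  by rewrite scale1r -av.
Qed.

Lemma tower_free_sub n' :
  (forall i (S : Phi i -> Prop), submodule S -> rank_at_most S n' -> free_sub S) ->
  forall S : G -> Prop, submodule S -> rank_at_most S n' -> free_sub S.
Proof.
move=> Pfree S sS rS.
have [F FS] : exists F : seq T, forall x, S x -> below (fun v => v \in F) x.
  have [s [sS' sP]] := rank_at_most_span sS rS.
  have [F Fs] : exists F : seq T, forall x, x \in s -> below (fun v => v \in F) x.
    elim: (s) => [|x t [F Ft]]; first by exists [::].
    have [l lx] := gspan_fsupp (submod_valP x).
    exists ([seq z.1 | z <- l] ++ F) => y; rewrite inE => /orP[/eqP ->|/Ft].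
      by apply: supp_sub lx => z zl; rewrite mem_cat map_f.
    by apply: supp_sub => z zF; rewrite mem_cat zF orbT.
  (* A nonzero multiple of [x] is a combination of elements of [s], and scaling by [d] does not
     change the support. *)
  exists F => x /sP[d d0 [t [c [ts dx]]]].
  apply: (@supp_pure _ d) => //.
  rewrite -[_ *: _]/(val (d *: x)) dx.
  apply: (submodule_sum (below_submodule (fun v => v \in F))) => j _.
  by apply: (submoduleZ (below_submodule _)); apply/Fs/ts.
move sF : (size F) => m; elim: m => [|m IH] in F S sS rS FS sF *.
  exists (fun=> False); split=> //; split; first by move=> s c _ sn _ j /sn.
  move=> x /FS bx; rewrite (_ : x = 0); first exact: submodule0 (span_in_submodule _).
  apply: val_inj; apply/funext => z; apply/eqP; rewrite -[_ == _]negbK.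
  by apply/negP => /bx; rewrite (size0nil sF).
have [|a aF amax] := @seq_max F; first by rewrite -size_eq0 sF.
have SF x : S x -> below (le^~ a) x by move=> /FS; apply: supp_sub => z; exact: amax.
have [phi [phil _ phik]] := tower_quot a.
have philS r x y : S x -> S y -> phi (r *: x + y) = r *: phi x + phi y.
  by move=> Sx Sy; apply: phil; exact: SF.
have phi0 : phi 0 = 0 by apply/phik; exact: submodule0 (below_submodule _).
(* The image is a submodule of [Phi (idx a)] whose rank is still at most n'; the kernel is a
   submodule inside [S] that lives on one node fewer. *)
apply: (free_sub_extension sS philS); last first.
  apply: Pfree; last exact: rank_at_most_image.
  split=> [|r _ _ [x Sx <-] [y Sy <-]]; first by exists 0 => //; exact: submodule0.
  by exists (r *: x + y); [exact: sS.2|exact: philS].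
apply: (IH (rem a F)).
- split=> [|r x y [Sx x0] [Sy y0]]; first by split=> //; exact: submodule0.
  by split; [exact: sS.2|rewrite philS // x0 y0 scaler0 addr0].
- by move=> s us sK; apply: rS => // x /sK[].
- move=> x [Sx /(phik x (SF x Sx)).1 lx] z xz.
  have := FS x Sx z xz; rewrite (perm_mem (perm_to_rem aF)) inE => /orP[/eqP za|//].
  by have := lx z xz; rewrite za => /lt_irr.
- by rewrite size_rem // sF.
Qed.

End Tower.

(** * Well-orders, nodes and the construction *)

(** The well-ordering principle gives a unique least element in each nonempty set; the order axioms
    are read off from sets of at most three elements. *)
Lemma strict_well_order (T : eqType) : exists lt : T -> T -> Prop,
  [/\ forall a b c, lt a b -> lt b c -> lt a c, forall a, ~ lt a a,
      forall a b, a = b \/ lt a b \/ lt b a & well_founded lt].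
Proof.
have [r rwo] := well_ordering_principle T.
have mem_seq_pred (s : seq T) x : x \in s -> nonempty [pred y in s].
  by move=> xs; exists x.
have rr x : r x x.
  have [z [[]]] := rwo _ (mem_seq_pred [:: x] x (mem_head _ _)).
  by rewrite !inE => /eqP -> h _; apply: h; rewrite !inE.
have rtot x y : r x y || r y x.
  have [z [[]]] := rwo _ (mem_seq_pred [:: x; y] x (mem_head _ _)).
  rewrite !inE => /orP[] /eqP -> h _; apply/orP; [left|right]; apply: h.
    by rewrite !inE eqxx orbT.
  by rewrite !inE eqxx.
have ranti x y : r x y -> r y x -> x = y.
  move=> xy yx; have [z [_ zU]] := rwo _ (mem_seq_pred [:: x; y] x (mem_head _ _)).
  have zx : z = x.
    by apply: zU; split=> [|t]; rewrite !inE ?eqxx // => /orP[] /eqP ->.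
  have zy : z = y.
    by apply: zU; split=> [|t]; rewrite !inE ?eqxx ?orbT // => /orP[] /eqP ->.
  by rewrite -zx zy.
exists (fun a b => ~~ r b a); split.
- move=> a b c nba ncb; apply/negP => ca.
  have [z [[]]] := rwo _ (mem_seq_pred [:: a; b; c] a (mem_head _ _)).
  rewrite !inE => /or3P[] /eqP -> h _.
  + have ac : r a c by apply: h; rewrite !inE eqxx !orbT.
    have cE := ranti _ _ ca ac; move: ncb; rewrite cE => nab.
    by have := rtot a b; rewrite (negPf nab) (negPf nba).
  + by move: nba; rewrite h // !inE eqxx.
  + by move: ncb; rewrite h // !inE eqxx !orbT.
- by move=> a; rewrite rr.
- move=> a b; have [ba|nba] := boolP (r b a); last by right; left.
  have [ab|nab] := boolP (r a b); last by right; right.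
  by left; exact: ranti.
- move=> a; apply: contrapT => na.
  have [|z [[/asboolP nz zmin] _]] :=
    rwo (fun x => `[< ~ Acc (fun a b => ~~ r b a) x >]).
    by exists a; apply/asboolP.
  apply: nz; constructor=> y nzy; apply: contrapT => ny.
  by move: nzy; rewrite zmin //; apply/asboolP.
Qed.

(** * Extending a well-founded relation to a well-order *)

Section ExtendWellFounded.
Variables (T : eqType) (child : T -> T -> Prop).
Hypothesis child_wf : well_founded child.

(* [a] has well-founded rank at most that of [b]. *)
Inductive rle : T -> T -> Prop :=
  Rle a b : (forall c, child c a -> exists2 d, child d b & rle c d) -> rle a b.

Let rlt a b := exists2 c, child c b & rle a c.

Let rleP a b : rle a b -> forall c, child c a -> rlt c b.
Proof. by case. Qed.

Lemma rle_trans a b c : rle a b -> rle b c -> rle a c.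
Proof.
elim/(well_founded_ind child_wf): a b c => a IH b c ab bc; constructor=> d da.
have [e eb de] := rleP ab da; have [f fc ef] := rleP bc eb.
by exists f => //; exact: IH ef.
Qed.

(** If [rle a b] fails, some child c of [a] is [rle] to no child of [b]; by induction every child of
    [b] then ranks strictly below c, which means [rle b c]. *)
Lemma rle_total a b : rle a b \/ rlt b a.
Proof.
elim/(well_founded_ind child_wf): a b => a IH b.
have [ab|nab] := pselect (rle a b); [by left|right].
apply: contrapT => nba; apply: nab; constructor=> c ca; apply: contrapT => nc.
apply: nba; exists c => //; constructor=> d db.
by have [cd|//] := IH c ca d; exfalso; apply: nc; exists d.
Qed.

Lemma child_rle c b : child c b -> rle c b.
Proof.
elim/(well_founded_ind child_wf): c b => c IH b cb; constructor=> d dc.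
by exists c => //; exact: IH.
Qed.

Let rlt_rle a b : rlt a b -> rle a b.
Proof. by move=> [c cb ac]; exact: rle_trans ac (child_rle cb). Qed.

Let rlt_le_trans a b c : rlt a b -> rle b c -> rlt a c.
Proof.
move=> [d db ad] /rleP/(_ _ db)[e ec de]; exists e => //.
exact: rle_trans de.
Qed.

Let rle_lt_trans a b c : rle a b -> rlt b c -> rlt a c.
Proof. by move=> ab [d dc bd]; exists d => //; exact: rle_trans bd. Qed.

Lemma rlt_wf : well_founded rlt.
Proof.
suff h b a : rle a b -> Acc rlt a.
  move=> a; have [aa|[c ca ac]] := rle_total a a; first exact: h aa.
  exact: h ac.
elim/(well_founded_ind child_wf): b a => b IH a ab; constructor=> y [c ca yc].
have [d db cd] := rleP ab ca; apply: IH db _ _.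
exact: rle_trans cd.
Qed.

Let rlt_irr a : ~ rlt a a.
Proof. by elim/(well_founded_ind rlt_wf): a => a IH aa; exact: (IH a aa aa). Qed.

Let rle_refl a : rle a a.
Proof. by have [//|/rlt_irr] := rle_total a a. Qed.

(** The order is lexicographic: by rank, with ties broken by an arbitrary well-order. A child has
    smaller rank than its parent, so the order extends [child]. *)
Lemma extend_well_founded : exists lt : T -> T -> Prop,
  [/\ forall a b c, lt a b -> lt b c -> lt a c, forall a, ~ lt a a,
      forall a b, a = b \/ lt a b \/ lt b a & well_founded lt] /\
  forall c b, child c b -> lt c b.
Proof.
have [wo [wo_trans wo_irr wo_total wo_wf]] := strict_well_order T.
pose lt a b := rlt a b \/ [/\ rle a b, rle b a & wo a b].
exists lt; split; last by move=> c b cb; left; exists c.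
split.
- move=> a b c [ab|[ab ba wab]] [bc|[bc cb wbc]].
  + by left; apply: rlt_le_trans ab (rlt_rle bc).
  + by left; exact: rlt_le_trans bc.
  + by left; exact: rle_lt_trans bc.
  + by right; split; [exact: rle_trans bc|exact: rle_trans ba|exact: wo_trans wbc].
- by move=> a [/rlt_irr|[_ _ /wo_irr]].
- move=> a b; have [ab|ba] := rle_total a b; last by right; right; left.
  have [ba|ab'] := rle_total b a; last by right; left; left.
  by have [->|[wab|wba]] := wo_total a b; [left|right; left; right|right; right; right].
- elim/(well_founded_ind rlt_wf) => a IH.
  suff h b : rle b a -> rle a b -> Acc lt b by exact: h (rle_refl a) (rle_refl a).
  elim/(well_founded_ind wo_wf): b => b IHb ba ab; constructor=> y [yb|[yb by' wyb]].
    by apply: IH; exact: rlt_le_trans ba.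
  by apply: IHb => //; [exact: rle_trans ba|exact: rle_trans by'].
Qed.

End ExtendWellFounded.

(** Cantor-Bernstein for [T] and the subset [B], in the form in which the rank computation indexes
    basis positions by [K]. *)
Lemma Cantor_Bernstein_set (T U : Type) (B : set U) (f : T -> U) (g : U -> T) :
  injective f -> (forall a, B (f a)) -> injective g ->
  exists2 e : T -> U, injective e & forall u, B u <-> exists a, e a = u.
Proof.
move=> fi fB gi.
have /card_bijP[h [h' hK h'K]] : ([set: T] #= B)%card.
  apply: Cantor_Bernstein.
    have [|F] := (@injfunPex T U classical_sets.setT B).2; last exact: inj_card_le F.
    by exists f => [a _|a b _ _]; [exact: fB|exact: fi].
  have [|F] := (@injfunPex U T B classical_sets.setT).2; last exact: inj_card_le F.
  by exists g => // a b _ _; exact: gi.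
pose e a := val (h (SigSub (@mem_set T classical_sets.setT a Logic.I))).
exists e => [a b /val_inj/(can_inj hK)/(congr1 val)//|u]; split=> [Bu|[a <-]].
  pose t := h' (SigSub (mem_set Bu)).
  exists (val t); rewrite /e (_ : SigSub _ = t) ?h'K //; exact: val_inj.
exact: set_mem (valP (h _)).
Qed.

(** * The tree type of nodes, its cardinality and its generators *)

Section Node.
Variables (R : comNzRingType) (I K : Type).

(* [Nd i s h] is the request to solve the relations of [Phi i] with right-hand
   sides [sum_t r_t * g_t], where the t-th term of the m-th right-hand side has
   coefficient [(nth _ (s m) t).1] and is the generator of the node [h m t]
   named by [(nth _ (s m) t).2] ([inl j] for x_j, [inr j] for y_j). *)
Inductive node :=
| Leaf of K
| Nd of I & (nat -> seq (R * (nat + nat))) & (nat -> nat -> node).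

HB.instance Definition _ := gen_eqMixin node.

Definition child c v := if v is Nd _ _ h then exists m t, c = h m t else False.

Lemma child_wf : well_founded child.
Proof. elim=> [a|i s h IH]; constructor=> c; first by case.
by case=> m [t ->]; exact: IH. Qed.

Variables (iota : {rmorphism R -> rat}) (iota_inj : injective iota).

Lemma node_card : card_le I K -> card_le nat K -> card_le (nat -> K) K ->
  card_le (node * nat) K.
Proof.
move=> [fI fIi] [fN fNi] [fK fKi].
(* [l] is a path in the tree and [m] selects part of the label found there: 0 the constructor, 1 the
   leaf's element or the index, m'+2 the list [s m']. Such lists are countable in number because
   [iota] embeds [R] in the rationals. *)
pose enc := fix enc (v : node) (l : seq (nat * nat)) (m : nat) : K :=
  match v, l, m with
  | Leaf a, _, 0 => fN 0%N
  | Leaf a, _, _ => a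
  | Nd i s h, [::], 0 => fN 1%N
  | Nd i s h, [::], 1 => fI i
  | Nd i s h, [::], m'.+2 => fN (pickle [seq (iota q.1, q.2) | q <- s m'])
  | Nd i s h, (x, y) :: l', _ => enc (h x y) l' m
  end.
have enc_inj : injective enc.
  elim=> [a|i s h IH] [b|j s' h'] E.
  - by have /= -> := congr1 (fun e => e [::] 1%N) E.
  - by have /= /fNi := congr1 (fun e => e [::] 0%N) E.
  - by have /= /fNi := congr1 (fun e => e [::] 0%N) E.
  - have /= /fIi -> := congr1 (fun e => e [::] 1%N) E.
    have -> : s = s'.
      apply/funext => m; have /= /fNi := congr1 (fun e => e [::] m.+2) E.
      move=> /(pcan_inj pickleK); apply: inj_map => -[a b] [a' b'] /= [aa bb].
      by rewrite (iota_inj aa) bb.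
    congr Nd; apply/funext => m; apply/funext => t; apply: IH.
    apply/funext => l; apply/funext => m'.
    exact: (congr1 (fun e => e ((m, t) :: l) m') E).
(* Position 0 holds the second component; position q'+1 holds the label part numbered q'. There are
   countably many paths, so this is a sequence in [K], which [fK] compresses to one element. *)
pose code (z : node * nat) (q : nat) : K :=
  if q is q'.+1 then
    if (unpickle q' : option (seq (nat * nat) * nat)) is Some lm
    then enc z.1 lm.1 lm.2 else fN 0%N
  else fN z.2.
exists (fK \o code); apply: inj_comp fKi _ => -[v m] [v' m'] E.
have /= /fNi -> := congr1 (fun e => e 0%N) E; congr (_, _).
apply: enc_inj; apply/funext => l; apply/funext => q.
by have /= := congr1 (fun e => e (pickle (l, q)).+1) E; rewrite !pickleK.
Qed.

Variables (n : I -> nat) (p : I -> nat -> R) (k : I -> nat -> nat -> R) (i0 : I).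
Hypothesis p0 : forall i m, p i m != 0.
Local Notation V := (node * nat -> qmod iota).

(** Leaves get the fixed index [i0] and zero right-hand sides. They start the tree type and embed
    [K] in it, which keeps the rank from falling below that of [K]. *)
Definition nidx v := if v is Nd i _ _ then i else i0.

(** A name x_j with j out of range has value 0, so every piece of raw data is a legitimate node. *)
Definition term (gy : nat -> V) v (q : R * (nat + nat)) : V :=
  q.1 *: match q.2 with
         | inl j => if (j < n (nidx v))%N then gx iota v j else 0
         | inr m => gy m
         end.

(** The recursion is on the node alone and [yrec] produces all the y_m of a node together, so that a
    term may refer to any y_m of a child. *)
Fixpoint gy (v : node) : nat -> V :=
  yrec (p (nidx v)) (delta iota (v, 0%N)) (fun m =>
    \sum_(j < n (nidx v)) k (nidx v) j m *: gx iota v j +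
    if v is Nd i s h then
      \sum_(t < size (s m)) term (gy (h m t)) (h m t) (nth (0, inl 0%N) (s m) t)
    else 0).

Definition nrhs v m : V :=
  if v is Nd i s h then
    \sum_(t < size (s m)) term (gy (h m t)) (h m t) (nth (0, inl 0%N) (s m) t)
  else 0.

Lemma gy0 v : gy v 0%N = delta iota (v, 0%N).
Proof. by case: v. Qed.

Lemma gyS v m : p (nidx v) m *: gy v m.+1 =
  gy v m + \sum_(j < n (nidx v)) k (nidx v) j m *: gx iota v j + nrhs v m.
Proof. by case: v => [a|i s h]; rewrite -addrA; exact: yrecS. Qed.

Local Notation nspan := (@gspan R iota I n node nidx gy).

Lemma nrhs_span (lt : node -> node -> Prop) v m :
  (forall c b, child c b -> lt c b) -> nspan (lt^~ v) (nrhs v m).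
Proof.
move=> clt; case: v => [a|i s h] /=; first exact: gspan0.
apply: submodule_sum => [|t _]; first exact: gspan_submodule.
have ltv : lt (h m t) (Nd i s h) by apply: clt; exists m, t.
rewrite /term; apply: submoduleZ; first exact: gspan_submodule.
case: (nth _ _ _).2 => [j|m']; last exact: gspan_Y.
by case: ifP => jn; [exact: gspan_X|exact: gspan0].
Qed.

Lemma nspan_terms (P : node -> Prop) w (a : K) : nspan P w ->
  exists (s : seq (R * (nat + nat))) (h : nat -> node),
    w = \sum_(t < size s) term (gy (h t)) (h t) (nth (0, inl 0%N) s t).
Proof.
elim=> [|r v j w' _ jn _ [s [h ->]]|r v m w' _ _ [s [h ->]]].
- by exists [::], (fun=> Leaf a); rewrite big_ord0.
- exists ((r, inl j) :: s), (fun t => if t is t'.+1 then h t' else v).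
  by rewrite big_ord_recl /term /= jn.
- exists ((r, inr m) :: s), (fun t => if t is t'.+1 then h t' else v).
  by rewrite big_ord_recl /term.
Qed.

Lemma nrhs_surj (a : K) i (g : nat -> V) :
  (forall m, nspan (fun=> True) (g m)) ->
  exists v, nidx v = i /\ forall m, nrhs v m = g m.
Proof.
move=> gP; have /choice[s sP] := fun m => nspan_terms a (gP m).
have /choice[h hP] := sP.
by exists (Nd i s h); split=> // m; rewrite [RHS]hP.
Qed.

End Node.

Theorem theorem4p8
  (R : comNzRingType) (iota : {rmorphism R -> rat})
  (iota_inj : injective iota) (iota_proper : exists q : rat, forall r : R, iota r != q)
  (I : Type) (Phi : I -> lmodType R) (I_ne : inhabited I)
  (HPhi : forall i, finite_rank_free_by_1 (Phi i))
  (K : Type) (HKreg : infinite_regular K) (HKw : card_eq (nat -> K) K)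
  (HIK : card_lt I K) :
  exists G : lmodType R,
    [/\ torsion_free G, Phi_complete Phi G, Phi_represented Phi G, rank_is G K &
        forall n : nat, (forall i, rank_at_least (Phi i) n.+1) ->
          forall S : G -> Prop, submodule S -> rank_at_most S n -> free_sub S].
Proof.
have [i0] := I_ne; have [[fN fNi] _] := HKreg.
(* One tuple holds all the data, so that a single choice fixes the presentation together with the
   freeness clause for the same n. *)
have D i : exists d :
    nat * (nat -> R) * (nat -> nat -> R) * (nat -> Phi i) * (nat -> Phi i),
    let: (n, p, k, x, y) := d in pres n p k x y /\
    forall S : Phi i -> Prop, submodule S -> rank_at_most S n -> free_sub S.
  have [n [/presented_pres[p [k [x [y xy]]]] _ nfree]] := HPhi i.
  by exists (n, p, k, x, y); split=> //; exact: nfree.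
pose d i := projT1 (cid (D i)).
pose n i := (d i).1.1.1.1; pose p i := (d i).1.1.1.2; pose k i := (d i).1.1.2.
pose px i := (d i).1.2; pose py i := (d i).2.
have dP i : pres (n i) (p i) (k i) (px i) (py i) /\
    forall S : Phi i -> Prop, submodule S -> rank_at_most S (n i) -> free_sub S.
  by have := projT2 (cid (D i)); rewrite /n /p /k /px /py /d;
    case: (projT1 _) => -[[[]]].
have presP i := (dP i).1.
have p0 i m : p i m != 0 by case: (presP i).
pose T := node R I K; pose idx := @nidx R I K i0.
have [lt [[lt_trans lt_irr lt_total lt_wf] clt]] :=
  extend_well_founded (@child_wf R I K).
pose Y := @gy R I K iota n p k i0.
have Y0 := @gy0 R I K iota n p k i0.
have YS := @gyS R I K iota iota_inj n p k i0 p0.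
have rhs_span v m := @nrhs_span R I K iota n p k i0 lt v m clt.
have rhs_surj := @nrhs_surj R I K iota n p k i0 (fN 0%N).
have Kw : card_le (nat -> K) K.
  by have [f fb] := HKw; exists f; exact: bij_inj.
have [g gi] := node_card iota_inj HIK.1 HKreg.1 Kw.
exists (tower n idx Y); split.
- exact: tower_torsion_free.
- exact: (tower_complete presP YS rhs_surj).
- exact: (tower_represented iota_inj presP lt_trans lt_irr lt_total lt_wf Y0 YS rhs_span).
(* The leaves embed [K] in the set of basis positions, and the coding [g] embeds the positions in
   [K]. *)
- pose f a : T * nat := (Leaf R I a, 0%N).
  have fi : injective f by move=> a b [].
  have [e ei eP] := @Cantor_Bernstein_set K (T * nat)
    (fun z => (z.2 <= n (idx z.1))%N) f g fi (fun=> isT) gi.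
  exact: (tower_rank iota_inj presP lt_wf Y0 YS rhs_span ei eP).
(* By [pres_rank], rank at least n'+1 forces n' to be at most n i, so a submodule of [Phi i] of rank
   at most n' falls under the freeness clause of [Phi i]. *)
move=> n' rkP;
  apply: (tower_free_sub iota_inj presP lt_trans lt_irr lt_total lt_wf Y0 YS rhs_span).
move=> i S sS rS; apply: (dP i).2 => // s us sS' iS.
apply: leq_trans (rS s us sS' iS) _.
exact: (pres_rank iota_inj (p0 i) (presP i)).
Qed.
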